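(* Let $n \geq 3$. The palindromic Torelli group $\mathcal{PI}_n$ of the free group $F_n$ is generated by the set of all doubled commutator transvections in $\mathcal{PI}_n$ together with all separating $\pi$-twists in $\mathcal{PI}_n$.
   Context: Let $F_n$ be the free group on a fixed free basis $X=\{x_1,\dots,x_n\}$. For a word $w=l_1\cdots l_k$ on $X^{\pm1}$, its reverse is $w^{\mathrm{rev}}=l_k\cdots l_1$ (this induces a well-defined operation on $F_n$); $w$ is a palindrome on $X$ if $w^{\mathrm{rev}}=w$. The palindromic automorphism group $\Pi\mathrm{A}_n\leq\mathrm{Aut}(F_n)$ consists of those $\alpha$ such that each $\alpha(x_i)$ may be written as a palindrome on $X$. The palindromic Torelli group $\mathcal{PI}_n$ is the subgroup of $\Pi\mathrm{A}_n$ consisting of those elements acting trivially on the abelianisation $\mathbb{Z}^n$ of $F_n$. A $\pi$-basis is a set of the form $\alpha(X)$ with $\alpha\in\Pi\mathrm{A}_n$. Write $[g,h]=ghg^{-1}h^{-1}$. An element $\phi\in\mathcal{PI}_n$ is a doubled commutator transvection if there are a $\pi$-basis $Y$ and distinct $y_1,y_2,y_3\in Y$ such that $\phi(y_1)=[y_2,y_3]^{\mathrm{rev}}\,y_1\,[y_2,y_3]$ and $\phi$ fixes every other member of $Y$. An element $\phi\in\mathcal{PI}_n$ is a separating $\pi$-twist if there are a $\pi$-basis $Y$ and distinct $y_1,y_2,y_3\in Y$ such that, with $d=y_1^{-1}y_2^{-1}y_3^{-1}y_1y_2y_3$, one has $\phi(y_1)=d^{\mathrm{rev}}y_1d$, $\phi(y_2)=d^{-1}y_2(d^{\mathrm{rev}})^{-1}$,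 $\phi(y_3)=d^{\mathrm{rev}}y_3d$, and $\phi$ fixes every other member of $Y$. *)

(* Defs.v *)
From HB Require Import structures.
From mathcomp Require Import all_boot.
From mathcomp Require Import boolp classical_sets.

Set Implicit Arguments.
Unset Strict Implicit.
Unset Printing Implicit Defensive.

Local Open Scope group_scope.
Local Open Scope classical_set_scope.

(* The free group on x_0, ..., x_(n-1) is the type of freely reduced words;
   the letter (i, true) is x_i and (i, false) is its inverse. *)
Section FreeGroup.
Variable n : nat.

Definition letter : Type := ('I_n * bool)%type.
Definition linv (l : letter) : letter := (l.1, ~~ l.2).

Definition reduced (w : seq letter) : bool :=
  sorted (fun k l : letter => k != linv l) w.

Definition push (l : letter) (w : seq letter) : seq letter :=
  if w is k :: w' then if l == linv k then w' else l :: w else [:: l].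
Definition reduce (w : seq letter) : seq letter := foldr push [::] w.

Lemma linvK : involutive linv.
Proof. by case=> i b; rewrite /linv /= negbK. Qed.

Lemma push_reduced l w : reduced w -> reduced (push l w).
Proof.
case: w => [|k w] //= rw; case: eqP => [_|/eqP lk]; first exact: path_sorted rw.
by rewrite /reduced /= lk.
Qed.

Lemma reduce_reduced w : reduced (reduce w).
Proof. by elim: w => //= l w IH; apply: push_reduced. Qed.

Lemma reduce_id w : reduced w -> reduce w = w.
Proof.
elim: w => //= l w IH rw; rewrite IH; last exact: path_sorted rw.
by case: w rw {IH} => //= k w /andP[/negPf ->].
Qed.

Lemma pushK l w : reduced w -> push l (push (linv l) w) = w.
Proof.
case: w => [|k w] /=; first by rewrite linvK eqxx.
rewrite (can_eq linvK); case: eqP => [<-|_] rw /=; last by rewrite linvK eqxx.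
by case: w rw => //= m w /andP[/negPf ->].
Qed.

Lemma foldr_push_reduced u r : reduced r -> reduced (foldr push r u).
Proof. by move=> rr; elim: u => //= l u; apply: push_reduced. Qed.

Lemma foldr_push_cancel l w r :
  reduced r -> foldr push r (push l w) = push l (foldr push r w).
Proof.
move=> rr; case: w => //= k w; case: eqP => // ->.
by rewrite -{2}[k]linvK pushK // foldr_push_reduced.
Qed.

Lemma foldr_push_reduce u r :
  reduced r -> foldr push r (reduce u) = foldr push r u.
Proof. by move=> rr; elim: u => //= l u IH; rewrite foldr_push_cancel ?IH. Qed.

Lemma reduce_cat u v : reduce (u ++ v) = foldr push (reduce v) u.
Proof. by rewrite /reduce foldr_cat. Qed.

Lemma reduce_catl u v : reduce (reduce u ++ v) = reduce (u ++ v).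
Proof. by rewrite !reduce_cat foldr_push_reduce // reduce_reduced. Qed.

Lemma reduce_catr u v : reduce (u ++ reduce v) = reduce (u ++ v).
Proof. by rewrite !reduce_cat (reduce_id (reduce_reduced v)). Qed.

Record free := Free { fword :> seq letter; _ : reduced fword }.
HB.instance Definition _ := [isSub for fword].
HB.instance Definition _ := [Countable of free by <:].

Definition word (w : seq letter) : free := Free (reduce_reduced w).

Lemma wordK (g : free) : word (fword g) = g.
Proof. by apply: val_inj; case: g => w rw /=; rewrite reduce_id. Qed.

Definition fmul (g h : free) : free := word (fword g ++ fword h).
Definition finv (g : free) : free := word (rev (map linv (fword g))).

Lemma fmulA : associative fmul.
Proof.
by move=> a b c; apply: val_inj; rewrite /= reduce_catr reduce_catl catA.
Qed.

Lemma fmul1g : left_id (word [::]) fmul.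
Proof. exact: wordK. Qed.

Lemma fmulg1 : right_id (word [::]) fmul.
Proof. by move=> g; rewrite /fmul /= cats0 wordK. Qed.

Lemma reduce_invl w : reduce (rev (map linv w) ++ w) = [::].
Proof.
elim: w => //= l w IH; rewrite rev_cons -cats1 -catA /= reduce_cat /=.
rewrite -{2}[l]linvK pushK ?reduce_reduced //.
by rewrite -reduce_cat.
Qed.

Lemma fmulVg : left_inverse (word [::]) finv fmul.
Proof.
by move=> g; apply: val_inj; rewrite /= reduce_catl reduce_invl.
Qed.

Lemma fmulgV : right_inverse (word [::]) finv fmul.
Proof.
move=> g; apply: val_inj; rewrite /= reduce_catr.
have /= := reduce_invl (rev (map linv (fword g))).
by rewrite map_rev revK -map_comp map_id_in // => l _ /=; rewrite linvK.
Qed.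

HB.instance Definition _ := isGroup.Build free fmulA fmul1g fmulg1 fmulVg fmulgV.

Definition gen (i : 'I_n) : free := word [:: (i, true)].

Definition frev (g : free) : free := word (rev (fword g)).

(* Reversal descends from words to elements of the free group. *)
Lemma frev_word (w : seq letter) : frev (word w) = word (rev w).
Proof.
apply: val_inj => /=; elim: w => //= l w IH.
rewrite rev_cons -cats1 -reduce_catl -IH reduce_catl.
case: (reduce w) => [|k v] //=; case: eqP => [->|_]; last first.
  by rewrite !rev_cons -!cats1.
rewrite rev_cons -cats1 -catA /= !reduce_cat /= eq_sym.
by rewrite -{2}[k]linvK eqxx.
Qed.

Definition is_palindrome (g : free) : Prop :=
  exists w : seq letter, rev w = w /\ word w = g.

End FreeGroup.

Section AutGroup.
Variable G : groupType.

Record aut := Aut {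
  aut_fun :> G -> G;
  aut_inv : G -> G;
  _ : {morph aut_fun : x y / x * y};
  _ : cancel aut_fun aut_inv;
  _ : cancel aut_inv aut_fun }.

Lemma autM (f : aut) : {morph f : x y / x * y}. Proof. by case: f. Qed.
Lemma autK (f : aut) : cancel f (aut_inv f). Proof. by case: f. Qed.
Lemma autVK (f : aut) : cancel (aut_inv f) f. Proof. by case: f. Qed.

Lemma autP (f g : aut) : f =1 g -> f = g.
Proof.
move=> fg; have fgE : aut_fun f = aut_fun g by apply: funext.
have fgV : aut_inv f = aut_inv g.
  by apply: funext => x; apply: (can_inj (autK f)); rewrite autVK fg autVK.
case: f g fgE fgV {fg} => [f f' fM fK f'K] [g g' gM gK g'K] /= fE f'E.
by subst g g'; congr Aut; apply: Prop_irrelevance.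
Qed.

HB.instance Definition _ := gen_eqMixin aut.
HB.instance Definition _ := gen_choiceMixin aut.

Definition aut_one : aut :=
  @Aut id id (fun _ _ => erefl) (fun _ => erefl) (fun _ => erefl).

Lemma aut_compM (f g : aut) : {morph f \o g : x y / x * y}.
Proof. by move=> x y /=; rewrite !autM. Qed.

Definition aut_comp (f g : aut) : aut :=
  Aut (aut_compM f g) (can_comp (autK f) (autK g)) (can_comp (autVK g) (autVK f)).

Lemma aut_invM (f : aut) : {morph aut_inv f : x y / x * y}.
Proof. by move=> x y; apply: (can_inj (autK f)); rewrite autM !autVK. Qed.

Definition aut_V (f : aut) : aut := Aut (aut_invM f) (autVK f) (autK f).

Lemma aut_compA : associative aut_comp.
Proof. by move=> f g h; apply: autP. Qed.
Lemma aut_comp1f : left_id aut_one aut_comp.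
Proof. by move=> f; apply: autP. Qed.
Lemma aut_compf1 : right_id aut_one aut_comp.
Proof. by move=> f; apply: autP. Qed.
Lemma aut_compVf : left_inverse aut_one aut_V aut_comp.
Proof. by move=> f; apply: autP => x /=; rewrite autK. Qed.
Lemma aut_compfV : right_inverse aut_one aut_V aut_comp.
Proof. by move=> f; apply: autP => x /=; rewrite autVK. Qed.

HB.instance Definition _ :=
  isGroup.Build aut aut_compA aut_comp1f aut_compf1 aut_compVf aut_compfV.

End AutGroup.

Definition is_subgroup (G : groupType) (H : set G) : Prop :=
  [/\ H 1, forall x y, H x -> H y -> H (x * y) & forall x, H x -> H x^-1].

Definition generated (G : groupType) (S : set G) : set G :=
  smallest (@is_subgroup G) S.

(* The library's [~ g, h] is g^-1 * h^-1 * g * h. *)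
Definition comm (G : groupType) (g h : G) : G := g * h * g^-1 * h^-1.

Definition derived (G : groupType) : set G :=
  generated [set c | exists g h : G, c = comm g h].

(* phi g and g have the same image in G / [G, G] for every g. *)
Definition trivial_on_abelianisation (G : groupType) (phi : aut G) : Prop :=
  forall g : G, derived (phi g * g^-1).

Definition palindromic_aut (n : nat) : set (aut (free n)) :=
  [set phi | forall i : 'I_n, is_palindrome (phi (gen i))].

Definition palindromic_torelli (n : nat) : set (aut (free n)) :=
  [set phi | palindromic_aut phi /\ trivial_on_abelianisation phi].

Definition is_pi_basis (n : nat) (Y : set (free n)) : Prop :=
  exists2 phi : aut (free n), palindromic_aut phi & Y = phi @` range (@gen n).

Definition doubled_commutator_transvection (n : nat) : set (aut (free n)) :=
  [set phi | palindromic_torelli phi /\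
    exists Y : set (free n), is_pi_basis Y /\
    exists y1 y2 y3 : free n,
      [/\ [/\ Y y1, Y y2 & Y y3], [/\ y1 <> y2, y1 <> y3 & y2 <> y3],
          phi y1 = frev (comm y2 y3) * y1 * comm y2 y3
        & forall y, Y y -> y <> y1 -> phi y = y]].

Definition separating_pi_twist (n : nat) : set (aut (free n)) :=
  [set phi | palindromic_torelli phi /\
    exists Y : set (free n), is_pi_basis Y /\
    exists y1 y2 y3 : free n,
      [/\ [/\ Y y1, Y y2 & Y y3], [/\ y1 <> y2, y1 <> y3 & y2 <> y3],
          let d := y1^-1 * y2^-1 * y3^-1 * y1 * y2 * y3 in
          [/\ phi y1 = frev d * y1 * d,
              phi y2 = d^-1 * y2 * (frev d)^-1
            & phi y3 = frev d * y3 * d]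
        & forall y, Y y -> y <> y1 -> y <> y2 -> y <> y3 -> phi y = y]].

(* Main.v *)
(* Write P_ij for x_j |-> x_i x_j x_i, which acts on Z^n as the elementary matrix
   S_ij with a 2 in position (i, j).  Two facts give the theorem.

   (1) A palindromic automorphism that is trivial on H_1 mod 2 is a product of the
   P_ij and of inversions of generators.  The images of the generators and their
   inverses are palindromes w c w^rev of odd length.  If their half words w c form
   a prefix code then ping-pong shows that every x_i is one of these images;
   otherwise one half word starts another and some P_ij shortens the images.

   (2) Let N be generated by the doubled commutator transvections and separating
   pi-twists; N is normal in the palindromic automorphism group.  Modulo N the P_ij
   and the inversions satisfy enough relations to present the level 2 congruence
   subgroup of GL(n, Z), so that a product of them acting trivially on Z^n is in N.
   This is shown by induction on the number of coordinates involved: the stabiliser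
   of a basis vector is generated by the generators fixing it.  To see that, follow
   the orbit of the vector along a word and remove the peaks of the L1 norm.  One
   coordinate of the vector is odd and all others are even, so that the only
   delicate peak is at (o, x, x) with x < o < 2x; there the relation coming from
   the separating pi-twists is needed. *)

From Stdlib Require Import ZArith Lia.
From HB Require Import structures.
Require Import Defs.
From mathcomp Require Import all_boot.
From mathcomp Require Import boolp classical_sets.

Set Implicit Arguments.
Unset Strict Implicit.
Unset Printing Implicit Defensive.

Local Open Scope group_scope.
Local Arguments Z.add : simpl never.
Local Arguments Z.sub : simpl never.
Local Arguments Z.mul : simpl never.
Local Arguments Z.opp : simpl never.
Local Arguments Z.abs : simpl never.

HB.instance Definition _ :=
  Monoid.isComLaw.Build Z 0%Z Z.add Z.add_assoc Z.add_comm Z.add_0_l.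

(** * The level 2 congruence subgroup of GL(n, Z) *)

Section IntegerVectors.
Variable n : nat.

Definition vec := 'I_n -> Z.

Definition upd (v : vec) (i : 'I_n) (x : Z) : vec :=
  fun m => if m == i then x else v m.

Definition signz (e : bool) : Z := if e then 1%Z else (-1)%Z.

Definition transv (e : bool) (i j : 'I_n) (v : vec) : vec :=
  upd v i (v i + 2 * signz e * v j)%Z.

Definition flip (i : 'I_n) (v : vec) : vec := upd v i (- v i)%Z.

Definition unit_vec (i : 'I_n) : vec := fun m => if m == i then 1%Z else 0%Z.

Definition sumf (f : Z -> Z) (v : vec) : Z := \big[Z.add/0%Z]_(m < n) f (v m).

Definition norm : vec -> Z := sumf Z.abs.

Lemma sumf_upd f v i x : sumf f (upd v i x) = (sumf f v - f (v i) + f x)%Z.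
Proof.
rewrite /sumf (bigD1 i) // [in RHS](bigD1 i) //= /upd eqxx.
rewrite (eq_bigr (fun m => f (v m))); first by lia.
by move=> m /negPf ->.
Qed.

Lemma sumf_ge0 f v : (forall x, 0 <= f x)%Z -> (0 <= sumf f v)%Z.
Proof. by move=> f0; apply: (big_ind (fun x => 0 <= x)%Z) => //; lia. Qed.

Lemma norm_ge0 v : (0 <= norm v)%Z.
Proof. by apply: sumf_ge0 => x; lia. Qed.

Lemma transvE e i j v m :
  transv e i j v m = if m == i then (v i + 2 * signz e * v j)%Z else v m.
Proof. by []. Qed.

Lemma flipE i v m : flip i v m = if m == i then (- v i)%Z else v m.
Proof. by []. Qed.

Lemma norm_transv e i j v :
  norm (transv e i j v) =
  (norm v - Z.abs (v i) + Z.abs (v i + 2 * signz e * v j))%Z.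
Proof. exact: sumf_upd. Qed.

Lemma norm_flip i v : norm (flip i v) = norm v.
Proof. by rewrite [LHS]sumf_upd /norm; lia. Qed.

Lemma transvK e i j v : i != j -> transv (~~ e) i j (transv e i j v) = v.
Proof.
move=> ij; apply: funext => m; rewrite !transvE (eq_sym j) (negPf ij) eqxx.
by case: eqP => // ->; case: e; rewrite /signz /=; lia.
Qed.

Lemma transv_flip e i j m v : i != j ->
  transv (e (+) ((m == i) || (m == j))) i j (flip m v) = flip m (transv e i j v).
Proof.
move=> ij; apply: funext => l; rewrite !(transvE, flipE).
case: (eqVneq m i) => [->|mi] /=.
  rewrite (eq_sym j) (negPf ij); case: (eqVneq l i) => // _.
  by case: e; rewrite /signz /=; lia.
case: (eqVneq m j) => [->|mj] /=.
  case: (eqVneq l i) => [->|//].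
  by rewrite (negPf ij); case: e; rewrite /signz /=; lia.
rewrite addbF; case: (eqVneq l i) => [->|//].
by rewrite eq_sym (negPf mi).
Qed.

End IntegerVectors.

Arguments norm_ge0 {n} v.

(** For [A] closed under inversion this is the subgroup generated by [A], in a form that allows
    induction on the first letter. *)
Inductive word_in (G : groupType) (A : G -> Prop) : G -> Prop :=
| word_nil : word_in A 1
| word_cons a g : A a -> word_in A g -> word_in A (a * g).

Section Words.
Variables (G : groupType) (A : G -> Prop).
Hypothesis A_inv : forall a, A a -> A a^-1.

Lemma word_gen a : A a -> word_in A a.
Proof. by rewrite -[a in word_in _ a]mulg1 => Aa; do 2?constructor. Qed.

Lemma word_mul g h : word_in A g -> word_in A h -> word_in A (g * h).
Proof.
by move=> Ag Ah; elim: Ag => [|a x Aa _ IH]; rewrite ?mul1g // -mulgA; constructor.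
Qed.

Lemma word_inv g : word_in A g -> word_in A g^-1.
Proof.
elim=> [|a x Aa _ IH]; first by rewrite invg1; constructor.
by rewrite invgM; apply: word_mul => //; apply/word_gen/A_inv.
Qed.

Lemma word_mulr g h : word_in A h -> word_in A (g * h) <-> word_in A g.
Proof.
move=> Ah; split=> Ag; last exact: word_mul.
by rewrite -[g](mulgK h); apply: word_mul => //; apply: word_inv.
Qed.

End Words.

(* The relations of the level 2 congruence subgroup of GL(n, Z): [S i j] stands
   for the elementary matrix with a 2 in position (i, j), [D i] for the diagonal
   matrix with a -1 in position i. *)
Record level2_system (n : nat) (Q : groupType) (S : 'I_n -> 'I_n -> Q)
  (D : 'I_n -> Q) (rho : Q -> vec n -> vec n) : Prop := Level2System {
  rho1 : forall v, rho 1 v = v;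
  rhoM : forall x y v, rho (x * y) v = rho x (rho y v);
  rho_elem : forall i j v, i != j -> rho (S i j) v = transv true i j v;
  rho_sign : forall i v, rho (D i) v = flip i v;
  signV : forall i, (D i)^-1 = D i;
  signC : forall i j, D i * D j = D j * D i;
  sign_target : forall i j, i != j -> D i * S i j * D i = (S i j)^-1;
  sign_source : forall i j, i != j -> D j * S i j * D j = (S i j)^-1;
  sign_other : forall i j m, i != j -> m != i -> m != j -> D m * S i j * D m = S i j;
  S_target : forall i j k, i != j -> i != k -> S i j * S i k = S i k * S i j;
  S_source : forall i j k, i != k -> j != k -> S i k * S j k = S j k * S i k;
  S_disjoint : forall i j k l, i != j -> k != l -> i != k -> i != l ->
    j != k -> j != l -> S i j * S k l = S k l * S i j;
  S_chain : forall i j k, i != j -> j != k -> i != k ->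
    S i j * S j k = S i k * S j k * S i k * S i j;
  S_triangle : forall i j k, i != j -> j != k -> i != k ->
    let w := S i j * (S i k)^-1 * S k i * S j i * S j k * (S k j)^-1 in w * w = 1 }.

(** * Peak reduction on the orbit of a basis vector *)

Section PeakReduction.
Variables (n : nat) (Q : groupType) (S : 'I_n -> 'I_n -> Q) (D : 'I_n -> Q).
Variable rho : Q -> vec n -> vec n.
Hypothesis sys : level2_system S D rho.

Definition Sg (e : bool) (i j : 'I_n) : Q := if e then S i j else (S i j)^-1.

Lemma SgV e i j : (Sg e i j)^-1 = Sg (~~ e) i j.
Proof. by case: e; rewrite //= invgK. Qed.

Lemma rhoV g v w : rho g v = w -> rho g^-1 w = v.
Proof. by move<-; rewrite -(rhoM sys) mulVg (rho1 sys). Qed.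

Lemma rho_Sg e i j v : i != j -> rho (Sg e i j) v = transv e i j v.
Proof.
move=> ij; case: e; first exact: (rho_elem sys).
by apply: rhoV; rewrite (rho_elem sys) // -[true]/(~~ false) transvK.
Qed.

Lemma sign_Sg e i j m : i != j ->
  D m * Sg e i j * D m = Sg (e (+) ((m == i) || (m == j))) i j.
Proof.
move=> ij.
have DS : D m * S i j * D m = Sg (true (+) ((m == i) || (m == j))) i j.
  case: (eqVneq m i) => [->|mi] /=; first exact: (sign_target sys).
  case: (eqVneq m j) => [->|mj] /=; first exact: (sign_source sys).
  exact: (sign_other sys).
case: e => //; apply: invg_inj; rewrite !invgM SgV (signV sys) mulgA DS SgV.
by case: (_ || _).
Qed.

Lemma commute_Sg e f i j k l :
  S i j * S k l = S k l * S i j -> Sg e i j * Sg f k l = Sg f k l * Sg e i j.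
Proof.
move=> c; have c1 : commute (S i j) (Sg f k l).
  by case: f => //; apply: commuteV.
by case: e => //=; apply/commute_sym/commuteV/commute_sym.
Qed.

Lemma Sg_target e f i j k : i != j -> i != k ->
  Sg e i j * Sg f i k = Sg f i k * Sg e i j.
Proof. by move=> *; apply/commute_Sg/(S_target sys). Qed.

Lemma Sg_source e f i j k : i != k -> j != k ->
  Sg e i k * Sg f j k = Sg f j k * Sg e i k.
Proof. by move=> *; apply/commute_Sg/(S_source sys). Qed.

Lemma Sg_disjoint e f i j k l : i != j -> k != l -> i != k -> i != l ->
  j != k -> j != l -> Sg e i j * Sg f k l = Sg f k l * Sg e i j.
Proof. by move=> *; apply/commute_Sg/(S_disjoint sys). Qed.

Lemma sign_sq m : D m * D m = 1.
Proof. by rewrite -{2}(signV sys m) mulgV. Qed.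

Lemma sign_conjM m x y : D m * (x * y) * D m = (D m * x * D m) * (D m * y * D m).
Proof. by rewrite !mulgA -(mulgA _ (D m) (D m)) sign_sq mulg1. Qed.

(** With positive signs this is [S_chain] rearranged by [S_source]. Conjugation by [D i] changes the
    signs at [(i, j)] and [(i, k)], conjugation by [D k] those at [(j, k)] and [(i, k)]; this
    reaches all sign patterns. *)
Lemma Sg_chain e f i j k : i != j -> j != k -> i != k ->
  Sg e i j * Sg f j k =
  Sg (e == f) i k * Sg (e == f) i k * Sg f j k * Sg e i j.
Proof.
move=> ij jk ik.
have base : Sg true i j * Sg true j k =
    Sg true i k * Sg true i k * Sg true j k * Sg true i j.
  rewrite [LHS](S_chain sys) // -!mulgA; congr (_ * _); rewrite !mulgA.
  by congr (_ * _); apply: (S_source sys).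
have conjD m x y : x = y -> D m * x * D m = D m * y * D m by move->.
have {}base : Sg e i j * Sg true j k =
    Sg e i k * Sg e i k * Sg true j k * Sg e i j.
  case: e => //; have := conjD i _ _ base.
  by rewrite !sign_conjM !sign_Sg // eqxx (negPf ij) (negPf ik).
case: f; first by rewrite base; case: e {base}.
have := conjD k _ _ base.
rewrite !sign_conjM !sign_Sg // !eqxx !(eq_sym k) (negPf jk) (negPf ik).
by case: e {base}.
Qed.

(* [S_triangle], conjugated by [D o] and solved for its second factor. *)
Lemma Sg_triangle o a b : o != a -> a != b -> o != b ->
  let x := Sg false b o * Sg false a o * Sg true a b * Sg false b a in
  Sg true o a * Sg false o b = x * (Sg false o a * Sg true o b) * x.
Proof.
move=> oa ab ob x; have := S_triangle sys oa ab ob; set w := (_ * _) => /= ww.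
have E : D o * (w * w) * D o = 1 by rewrite ww mulg1 sign_sq.
rewrite (_ : w = Sg true o a * Sg false o b * Sg true b o * Sg true a o *
              Sg true a b * Sg false b a) // in E.
rewrite !sign_conjM !sign_Sg // 1?eq_sym // 1?(eq_sym b) // eqxx
  !(negPf oa, negPf ob) /= !mulgA /= (eq_sym a o) (negPf oa) in E.
have : (Sg false o a * Sg true o b) * (x * (Sg false o a * Sg true o b) * x) = 1.
  by rewrite -[RHS]E /x !mulgA.
move/mulg1_eq => <-; rewrite invgM !SgV /=.
by apply: (Sg_target true false).
Qed.

Section Stabilizer.
Variable k : 'I_n.

(** [D k] is included although it negates [unit_vec k]: the chosen descents choose their coordinates
    by absolute values, so sign changes are absorbed in the coset. The factor [D k] is split off in
    [stab_split] and excluded in [level2_faithful]. *)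
Definition stab_gen (g : Q) : Prop :=
  (exists e (i j : 'I_n), [/\ k <= i, k <= j, i != j, j != k & g = Sg e i j])
  \/ exists2 i : 'I_n, k <= i & g = D i.

Local Notation stab := (word_in stab_gen).

Lemma stab_gen_inv g : stab_gen g -> stab_gen g^-1.
Proof.
case=> [[e [i [j [ki kj ij jk ->]]]]|[i ki ->]].
  by left; exists (~~ e), i, j; rewrite SgV.
by right; exists i; rewrite ?(signV sys).
Qed.

(** The class of [unit_vec k] modulo 2, which the moves preserve. Parity makes [v k] nonzero and
    distinct from every integer multiple of another coordinate, which excludes ties. *)
Definition admissible (v : vec n) : Prop :=
  (exists m, v k = 2 * m + 1)%Z /\ forall j, j != k -> exists m, (v j = 2 * m)%Z.

Lemma admissible_transv e i j v : i != j ->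
  admissible v -> admissible (transv e i j v).
Proof.
move=> ij [[a va] ev]; split=> [|m mk]; rewrite transvE; case: eqP => [im|_].
- by rewrite -im va; exists (a + signz e * v j)%Z; lia.
- by exists a.
- have [b ->] := ev i (introN eqP (fun ik => negP mk (introT eqP (etrans im ik)))).
  by exists (b + signz e * v j)%Z; lia.
- exact: ev.
Qed.

Lemma admissible_flip i v : admissible v -> admissible (flip i v).
Proof.
move=> [[a va] ev]; split=> [|m mk]; rewrite flipE; case: eqP => [im|_].
- by rewrite -im va; exists (- a - 1)%Z; lia.
- by exists a.
- by subst m; have [b ->] := ev i mk; exists (- b)%Z; lia.
- exact: ev.
Qed.

(* A move of [v] that strictly decreases the norm, between the coordinate [k]
   and another nonzero coordinate; [None] if there is no other. *)
Definition next (v : vec n) : option (bool * 'I_n * 'I_n) :=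
  omap (fun a => let e := (v k * v a <? 0)%Z in
                 if (Z.abs (v a) <? Z.abs (v k))%Z then (e, k, a) else (e, a, k))
    [pick a : 'I_n | (k < a) && ~~ (v a =? 0)%Z].

Variant next_spec (v : vec n) : option (bool * 'I_n * 'I_n) -> Prop :=
| NextNone of (forall j : 'I_n, k < j -> v j = 0%Z) : next_spec v None
| NextSome e (p q : 'I_n) of k <= p & k <= q & p != q & (p == k) || (q == k)
    & (Z.abs (v q) < Z.abs (v p))%Z & v q <> 0%Z & e = (v p * v q <? 0)%Z :
    next_spec v (Some (e, p, q)).

Lemma nextP v : admissible v -> next_spec v (next v).
Proof.
move=> [[a va] ev]; rewrite /next; case: pickP => [b /andP[kb]|h] /=; last first.
  by constructor=> j kj; move: (h j); rewrite kj => /negbFE/Z.eqb_spec.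
move/Z.eqb_spec => vb; have bk : b != k by rewrite neq_ltn kb orbT.
have [c vc] := ev b bk.
by case: Z.ltb_spec => lt; constructor;
  rewrite ?eqxx ?orbT ?(ltnW kb) // 1?eq_sym //; lia.
Qed.

Lemma next_some v e p q : admissible v -> next v = Some (e, p, q) ->
  [/\ k <= p, k <= q, p != q, (p == k) || (q == k) &
    [/\ (Z.abs (v q) < Z.abs (v p))%Z, v q <> 0%Z & e = (v p * v q <? 0)%Z]].
Proof. by move=> adm; case: nextP => // ? ? ? ? ? ? ? ? ? ? [<- <- <-]. Qed.

(* [coset v] is the coset of [stab] sending [v] to a vector supported on [k] by
   the chosen moves. *)
Inductive coset : vec n -> Q -> Prop :=
| coset_end v q : next v = None -> stab q -> coset v q
| coset_step v q e i j : next v = Some (e, i, j) ->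
    coset (transv e i j v) (q * (Sg e i j)^-1) -> coset v q.

Lemma coset_endE v q : next v = None -> coset v q <-> stab q.
Proof.
by move=> E; split=> [h|]; [case: h E => // ? ? ? ? ? -> | exact: coset_end].
Qed.

Lemma coset_stepE v q e i j : next v = Some (e, i, j) ->
  coset v q <-> coset (transv e i j v) (q * (Sg e i j)^-1).
Proof.
move=> E; split=> [h|]; last exact: coset_step.
by case: h E => [? ? ->|? ? ? ? ? -> ? [<- <- <-]].
Qed.

(* [equiv v g]: along [g], the chosen cosets at [v] and at [rho g v] agree. *)
Definition equiv (v : vec n) (g : Q) : Prop :=
  forall q, coset (rho g v) q <-> coset v (q * g).

Lemma equivM v g h : equiv v g -> equiv (rho g v) h -> equiv v (h * g).
Proof.
by move=> Eg Eh q; rewrite (rhoM sys) mulgA (Eh q) (Eg (q * h)).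
Qed.

Lemma equivV v g : equiv v g -> equiv (rho g v) g^-1.
Proof.
by move=> E q; rewrite E mulgVK -(rhoM sys) mulVg (rho1 sys).
Qed.

(** An edge may be exchanged for another one from the same vector once the path [h] joining their
    ends preserves the chosen cosets. This is how a peak is bypassed. *)
Lemma equiv_path v g t h : equiv (rho g v) h -> t = h * g ->
  (equiv v g <-> equiv v t).
Proof.
move=> E ->; split=> [Eg|Et]; first exact: equivM.
have -> : g = h^-1 * (h * g) by rewrite mulKg.
by apply: equivM => //; rewrite (rhoM sys); apply: equivV.
Qed.

Lemma norm_next v e p q : admissible v -> next v = Some (e, p, q) ->
  (norm (transv e p q v) < norm v)%Z.
Proof.
move=> adm /(next_some adm)[_ _ _ _ [lt nz ->]].
rewrite norm_transv; case: Z.ltb_spec; rewrite /signz; nia.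
Qed.

Lemma equiv_next v e p q : admissible v -> next v = Some (e, p, q) ->
  equiv v (Sg e p q).
Proof.
move=> adm E x; have [_ _ pq _ _] := next_some adm E.
by rewrite rho_Sg // [X in _ <-> X](coset_stepE _ E) mulgK.
Qed.

(** The coordinates are chosen by absolute values. The sign bit is that of a product of two nonzero
    coordinates, so it changes exactly when [m] is one of them. *)
Lemma next_flip m v : admissible v -> next (flip m v) =
  omap (fun '(e, p, q) => (e (+) ((m == p) || (m == q)), p, q)) (next v).
Proof.
move=> [[c vk] _]; have absE a : Z.abs (flip m v a) = Z.abs (v a).
  by rewrite flipE; case: eqP => // ->; lia.
rewrite /next; set P := fun a : 'I_n => _ && _; rewrite (@eq_pick _ _ P); last first.
  move=> a; rewrite /P; congr (_ && ~~ _).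
  by have := absE a; do 2 case: Z.eqb_spec => //; move=> *; exfalso; lia.
case: pickP => //= a /andP[ka /Z.eqb_spec va]; rewrite !absE.
have ak : (k == a) = false by apply/negbTE; rewrite neq_ltn ka.
have vka : (v k * v a)%Z <> 0%Z by move/Z.mul_eq_0 => []; have := absE a; lia.
have -> : (flip m v k * flip m v a <? 0)%Z =
    (v k * v a <? 0)%Z (+) ((m == k) || (m == a)).
  rewrite !flipE !(eq_sym _ m); case: (eqVneq m k) => [->|mk] /=.
    by rewrite ak; do 2 case: Z.ltb_spec => //; move=> *; exfalso; lia.
  case: (eqVneq m a) => [->|ma] /=; last by rewrite addbF.
  by do 2 case: Z.ltb_spec => //; move=> *; exfalso; lia.
by case: ifP => // _; rewrite orbC.
Qed.

Lemma Sg_sign e i j m : i != j ->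
  (Sg (e (+) ((m == i) || (m == j))) i j)^-1 * D m = D m * (Sg e i j)^-1.
Proof.
by move=> ij; rewrite -sign_Sg // !invgM (signV sys) -!mulgA sign_sq mulg1.
Qed.

(** The sign change is carried along the chosen descent, inverting some of its moves, until at the
    end [D m] lies in [stab]. The induction is on a bound for the norm. *)
Lemma equiv_flip (m : 'I_n) v : k <= m -> admissible v -> equiv v (D m).
Proof.
move=> km; have [K] : exists K : nat, (norm v < Z.of_nat K)%Z.
  by exists (Z.to_nat (norm v)).+1; have := norm_ge0 v; lia.
elim: K v => [|K IH] v ltK adm q; first by have := norm_ge0 v; lia.
have Dm : stab (D m) by apply: word_gen; right; exists m.
have := next_flip m adm; rewrite (rho_sign sys).
case E: (next v) => [[[e p] r]|] /= Ef; last first.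
  by rewrite !coset_endE //; split=> /(word_mulr stab_gen_inv _ Dm).
have [_ _ pr _ _] := next_some adm E.
rewrite (coset_stepE _ Ef) (coset_stepE _ E) transv_flip // -(rho_sign sys).
rewrite (IH (transv e p r v)) -?mulgA ?Sg_sign //; last exact: admissible_transv.
by have := norm_next adm E; lia.
Qed.

(** * Bypassing peaks *)

Ltac adm_tac := repeat (apply: admissible_transv => //).

(** The induction hypothesis of the peak reduction; [K] will be the norm of the peak to be
    removed. *)
Definition low (K : Z) : Prop :=
  forall e (i j : 'I_n) u, k <= i -> k <= j -> i != j -> admissible u ->
  (norm u < K)%Z -> (norm (transv e i j u) < K)%Z -> equiv u (Sg e i j).

Lemma low_cons K e (i j : 'I_n) u g : low K ->
  k <= i -> k <= j -> i != j -> admissible u ->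
  (norm u < K)%Z -> (norm (transv e i j u) < K)%Z ->
  equiv (transv e i j u) g -> equiv u (g * Sg e i j).
Proof.
move=> lowK ki kj ij adm lu lt E.
by apply: equivM; [exact: lowK | rewrite rho_Sg].
Qed.

Lemma transv_commute e f i j p q v : i != j -> p != q ->
  Sg e i j * Sg f p q = Sg f p q * Sg e i j ->
  transv e i j (transv f p q v) = transv f p q (transv e i j v).
Proof. by move=> ij pq; rewrite -!rho_Sg // -!(rhoM sys) => ->. Qed.

(** The peak is bypassed by the two opposite sides of the square of commuting moves, whose vertices
    all lie below [K]. *)
Lemma equiv_square K e (i j : 'I_n) f (p q : 'I_n) v : low K ->
  k <= i -> k <= j -> i != j -> k <= p -> k <= q -> p != q -> admissible v ->
  Sg e i j * Sg f p q = Sg f p q * Sg e i j ->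
  (norm (transv f p q v) < K)%Z -> (norm (transv e i j v) < K)%Z ->
  (norm (transv e i j (transv f p q v)) < K)%Z ->
  equiv v (Sg f p q) <-> equiv v (Sg e i j).
Proof.
move=> lowK ki kj ij kp kq pq adm c lp li lpi.
apply: (@equiv_path _ _ _ ((Sg f p q)^-1 * Sg e i j)); last first.
  by rewrite -mulgA c mulKg.
rewrite rho_Sg // SgV; apply: (low_cons lowK) => //; first by adm_tac.
apply: lowK => //; do ?[by adm_tac].
by rewrite (@transv_commute e f) // transvK.
Qed.

Ltac norm_lia :=
  repeat progress (rewrite ?norm_transv ?transvE ?eqxx;
    repeat match goal with H : (?a == ?b) = false |- _ => rewrite !H end);
  rewrite /signz; lia.

(* The peak between the moves [(q, r)] and [(p, q)] is bypassed by the moves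
   [(p, r)], [(p, q)], [(p, r)], applied after [(q, r)].  The case [v q = v p], in
   which [(p, q)] only changes a sign, serves for the moves preserving the norm. *)
Lemma equiv_chain K (p q r : 'I_n) v : low K ->
  k <= p -> k <= q -> k <= r -> p != q -> q != r -> p != r ->
  admissible v -> (norm v <= K)%Z -> (0 < v r < v q)%Z -> (v q <= v p)%Z ->
  equiv (transv false p q v) (Sg false q r) ->
  equiv v (Sg false q r) <-> equiv v (Sg false p q).
Proof.
move=> lowK kp kq kr pq qr pr adm nv rq lqp last_edge.
have BA : Sg false q r * Sg false p q =
    Sg false p r * (Sg false p q * (Sg false p r * Sg false q r)).
  rewrite (mulgA (Sg false p q)) (Sg_target false false pq pr) -!mulgA.
  by rewrite Sg_chain //= -!mulgA !mulKg.
apply: (@equiv_path _ _ _ ((Sg false q r)^-1 *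
    (Sg false p r * (Sg false p q * Sg false p r)))); last first.
  by rewrite -!mulgA -BA mulKg.
have [[pq' qr'] [pr' [qp' [rq' rp']]]] : ((p == q) = false /\ (q == r) = false) /\
   (p == r) = false /\ (q == p) = false /\ (r == q) = false /\ (r == p) = false.
  by rewrite !(eq_sym _ p) !(eq_sym r) !(negPf pq, negPf qr, negPf pr).
rewrite rho_Sg //; apply: equivM; last first.
  rewrite -rho_Sg // -(rhoM sys) -!mulgA -BA (rhoM sys) (rho_Sg _ _ pq).
  exact: equivV.
rewrite mulgA.
do 2 (apply: (low_cons lowK) => //; do ?[by adm_tac]; try norm_lia).
apply: lowK => //; do ?[by adm_tac]; norm_lia.
Qed.

Section Triangle.
Variables (K r : Z) (a b : 'I_n).
Hypothesis lowK : low K.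

(** [r] collects the coordinates other than [k], [a] and [b]. It stays constant along the path, so
    that only three explicit values have to be tracked. *)
Definition triangle_norm x y z := (r + Z.abs x + Z.abs y + Z.abs z)%Z.

Definition triangle_state u x y z :=
  [/\ admissible u, u k = x, u a = y, u b = z & norm u = triangle_norm x y z].

Lemma triangle_step e (i j : 'I_n) g u x y z x' y' z' :
  k <= i -> k <= j -> i != j -> triangle_state u x y z ->
  (triangle_norm x y z < K)%Z ->
  (triangle_state u x y z -> triangle_state (transv e i j u) x' y' z') ->
  (triangle_norm x' y' z' < K)%Z ->
  (forall w, triangle_state w x' y' z' -> equiv w g) -> equiv u (g * Sg e i j).
Proof.
move=> ki kj ij st lt st' lt' IH; have {}st' := st' st.
apply: (low_cons lowK) => //; last exact: IH.
- by case: st.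
- by case: st => _ _ _ _ ->.
- by case: st' => _ _ _ _ ->.
Qed.

End Triangle.

Ltac triangle_next st lowK x y z :=
  refine (triangle_step (x' := x) (y' := y) (z' := z) lowK _ _ _ st _ _ _ _);
  [ by [] | by [] | by [] | rewrite /triangle_norm; lia
  | case=> ? ? ? ?; rewrite {1}/triangle_norm => ?;
    split; [adm_tac | norm_lia | norm_lia | norm_lia
           | rewrite /triangle_norm; norm_lia]
  | rewrite /triangle_norm; lia | ].

(* Both moves send [v], with coordinates [(o, x, x)] at [(k, a, b)], to the same
   vector [(o - 2x, x, x)], where they differ by a loop.  By [Sg_triangle] that loop
   is conjugate, through vectors smaller than [v], to one at [(o - 2x, y, y)] with
   [y = 3x - 2o], and [|y| < x]. *)
Lemma equiv_triangle K (a b : 'I_n) v : low K ->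
  k <= a -> k <= b -> k != a -> a != b -> k != b ->
  admissible v -> (norm v <= K)%Z -> v a = v b ->
  (0 < v a < v k)%Z -> (v k < 2 * v a)%Z ->
  equiv v (Sg false k a) <-> equiv v (Sg false k b).
Proof.
move=> lowK ka kb nka nab nkb adm nv vab rq lqp.
have Eh := Sg_triangle nka nab nkb; cbv zeta in Eh; set h := (X in _ = X) in Eh.
have [nak nba nbk] : [/\ a != k, b != a & b != k].
  by rewrite !(eq_sym _ k) (eq_sym b) nka nab nkb.
apply: (@equiv_path _ _ _ h); last first.
  have := Sg_target true false nka nkb; rewrite Eh => ->.
  by rewrite /= mulgK.
rewrite rho_Sg // -[h]mul1g /h {h Eh} !mulgA.
have [[E1 E2] [E3 [E4 [E5 E6]]]] : ((k == a) = false /\ (a == b) = false) /\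
    (k == b) = false /\ (a == k) = false /\ (b == a) = false /\ (b == k) = false.
  by rewrite !(negPf nka, negPf nab, negPf nkb, negPf nak, negPf nba, negPf nbk).
pose y := (3 * v a - 2 * v k)%Z.
pose r := (norm v - Z.abs (v k) - Z.abs (v a) - Z.abs (v b))%Z.
have st : triangle_state r a b (transv false k a v) (v k - 2 * v a)%Z (v a) (v a).
  by split; [adm_tac | norm_lia | norm_lia | norm_lia
            | rewrite /triangle_norm /r; norm_lia].
have rK : (r + v k + 2 * v a <= K)%Z by rewrite /r; lia.
move: (transv _ _ _ _) r rK st => u r rK st.
have y_small : (Z.abs y < v a)%Z by rewrite /y; lia.
have yE : (y + 2 * v k = 3 * v a)%Z by rewrite /y; lia.
clearbody y.
triangle_next st lowK (v k - 2 * v a)%Z (v a) (- v a)%Z => {st}{}u st.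
triangle_next st lowK (v k - 2 * v a)%Z (- v a)%Z (- v a)%Z => {st}{}u st.
triangle_next st lowK (v k - 2 * v a)%Z y (- v a)%Z => {st}{}u st.
triangle_next st lowK (v k - 2 * v a)%Z y y => {st}{}u st.
triangle_next st lowK (v k - 2 * v a + 2 * y)%Z y y => {st}{}u st.
triangle_next st lowK (v k - 2 * v a)%Z y y => {st}{}u st.
triangle_next st lowK (v k - 2 * v a)%Z y (- y)%Z => {st}{}u st.
triangle_next st lowK (v k - 2 * v a)%Z (- y)%Z (- y)%Z => {st}{}u st.
triangle_next st lowK (v k - 2 * v a)%Z (v a)%Z (- y)%Z => {st}{}u st.
triangle_next st lowK (v k - 2 * v a)%Z (v a)%Z (v a)%Z => {st}{}u st.
by move=> q; rewrite (rho1 sys) mulg1.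
Qed.

Section Descent.
Variables (K : Z) (v : vec n).
Hypotheses (lowK : low K) (adm : admissible v) (normv : (norm v <= K)%Z).

Lemma norm_descent (i j : 'I_n) : i != j -> (0 < v j < v i)%Z ->
  (norm (transv false i j v) < K)%Z.
Proof. by move=> ij lt; norm_lia. Qed.

Lemma descent_chain (p q r : 'I_n) : k <= p -> k <= q -> k <= r ->
  p != q -> q != r -> p != r -> (0 < v r < v q)%Z -> (v q < v p)%Z ->
  equiv v (Sg false q r) <-> equiv v (Sg false p q).
Proof.
move=> kp kq kr pq qr pr lt1 lt2; apply: (equiv_chain lowK) => //; first by lia.
have [qp rq rp] : [/\ (q == p) = false, (r == q) = false & (r == p) = false].
  by rewrite !(eq_sym _ p) (eq_sym r) !(negPf pq, negPf qr, negPf pr).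
by apply: lowK => //; [adm_tac | norm_lia | norm_lia].
Qed.

Lemma descent_source (i j l : 'I_n) : k <= i -> k <= j -> k <= l ->
  i != l -> j != l -> (0 < v l < v i)%Z -> (0 < v l < v j)%Z ->
  equiv v (Sg false i l) <-> equiv v (Sg false j l).
Proof.
case: (eqVneq i j) => [-> //|ij] ki kj kl il jl lti ltj.
apply: (equiv_square lowK) => //; do ?exact: norm_descent.
  exact: Sg_source.
have ji : (j == i) = false by rewrite eq_sym (negPf ij).
have li : (l == i) = false by rewrite eq_sym (negPf il).
norm_lia.
Qed.

Lemma descent_disjoint (i j p q : 'I_n) : k <= i -> k <= j -> k <= p -> k <= q ->
  i != j -> p != q -> i != p -> i != q -> j != p -> j != q ->
  (0 < v j < v i)%Z -> (0 < v q < v p)%Z ->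
  equiv v (Sg false p q) <-> equiv v (Sg false i j).
Proof.
move=> ki kj kp kq ij pq ip iq jp jq lti ltp.
apply: (equiv_square lowK) => //; do ?exact: norm_descent.
  exact: Sg_disjoint.
rewrite norm_transv !transvE (negPf ip) (negPf jp).
by have := norm_descent pq ltp; rewrite /signz; lia.
Qed.

(** Let [v q <= v j]. If the inequality is strict, both moves are compared with the move [(j, q)].
    In case of equality parity forces [i = k] and [v k <> 2 * v j]: for [2 * v j < v k] the
    commuting square stays low, otherwise [equiv_triangle] is needed. *)
Lemma descent_target (i j q : 'I_n) : k <= i -> k <= j -> k <= q ->
  i != j -> i != q -> [|| i == k, j == k | q == k] ->
  (0 < v j < v i)%Z -> (0 < v q < v i)%Z ->
  equiv v (Sg false i j) <-> equiv v (Sg false i q).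
Proof.
wlog le : j q / (v q <= v j)%Z.
  move=> H ki kj kq ij iq e lj lq; case: (Z.le_ge_cases (v q) (v j)) => le.
    exact: H.
  by apply: iff_sym; apply: H => //; move: e; rewrite (orbC (j == k)).
case: (eqVneq j q) => [-> //|jq] ki kj kq ij iq e lj lq.
have ji : j != i by rewrite eq_sym.
have [lt|eqv] : (v q < v j \/ v j = v q)%Z by lia.
  rewrite -(descent_chain ki kj kq) //; try lia.
  by apply: iff_sym; apply: descent_source => //; lia.
have [ik jk qk] : [/\ i = k, j != k & q != k].
  have [[a va] ev] := adm; case: (eqVneq i k) e => [ik _|ik /= e].
    by rewrite -ik eq_sym; split=> //; rewrite eq_sym.
  exfalso; move: e jq; case: (eqVneq j k) => [jk|jk] /=.
    by rewrite jk eq_sym => _ /ev[b]; rewrite -eqv jk; lia.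
  by move/eqP => qk _; have [b] := ev j jk; rewrite qk in eqv; lia.
subst i; have [[a va] ev] := adm; have [b vb] := ev j jk.
have [lt|lt] : (v k < 2 * v j \/ 2 * v j < v k)%Z by lia.
  exact: (equiv_triangle lowK).
apply: (equiv_square lowK) => //; do ?exact: norm_descent.
  exact: Sg_target.
have qk' : (q == k) = false by rewrite (negPf qk).
norm_lia.
Qed.

(** The cases are how the two index pairs meet: common target, a chain in either direction, common
    source, or disjoint. Opposite pairs are ruled out by the inequalities. *)
Lemma equiv_descent (i j p q : 'I_n) : k <= i -> k <= j -> k <= p -> k <= q ->
  i != j -> p != q -> (p == k) || (q == k) ->
  (0 < v j < v i)%Z -> (0 < v q < v p)%Z ->
  equiv v (Sg false p q) -> equiv v (Sg false i j).
Proof.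
move=> ki kj kp kq ij pq pqk lti ltp E.
case: (eqVneq i p) => [ip|ip].
  subst p; apply/(descent_target (q := q)) => //.
  by case/orP: pqk => ->; rewrite ?orbT.
case: (eqVneq i q) => [iq|iq].
  subst q; have jp : p != j by apply/eqP => jp; rewrite jp in ltp; lia.
  by apply/(descent_chain (p := p)) => //; lia.
case: (eqVneq j q) => [jq|jq]; first by subst q; apply/(descent_source (j := p)).
case: (eqVneq j p) => [jp|jp].
  by subst p; apply/(descent_chain (r := q)) => //; lia.
by apply/(descent_disjoint (p := p) (q := q)).
Qed.

End Descent.

Lemma equiv_conj_flip e (i j m : 'I_n) v : k <= m -> i != j -> admissible v ->
  equiv (flip m v) (Sg (e (+) ((m == i) || (m == j))) i j) -> equiv v (Sg e i j).
Proof.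
move=> km ij adm; set f := e (+) _ => E.
have -> : Sg e i j = D m * (Sg f i j * D m) by rewrite mulgA sign_Sg // /f addbK.
apply: equivM; last first.
  rewrite !(rhoM sys) (rho_sign sys) rho_Sg // /f transv_flip //.
  by apply: equiv_flip => //; apply/admissible_flip/admissible_transv.
by apply: equivM; [exact: equiv_flip | rewrite (rho_sign sys)].
Qed.

(** The sum of [Z.abs x - x] over the coordinates measures the negative part, and it drops whenever
    a negative coordinate is flipped. *)
Lemma nonneg_ind (P : vec n -> Prop) :
  (forall v, admissible v -> (forall m : 'I_n, k <= m -> (0 <= v m)%Z) -> P v) ->
  (forall v (m : 'I_n), k <= m -> admissible v -> P (flip m v) -> P v) ->
  forall v, admissible v -> P v.
Proof.
move=> P0 Pflip v; pose f x := (Z.abs x - x)%Z.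
have f0 : forall w : vec n, (0 <= sumf f w)%Z.
  by move=> w; apply: sumf_ge0 => x; rewrite /f; lia.
have [N] : exists N : nat, (sumf f v < Z.of_nat N)%Z.
  by exists (Z.to_nat (sumf f v)).+1; have /= := f0 v; lia.
elim: N v => [|N IH] v ltN adm; first by have /= := f0 v; lia.
case: (pickP (fun m : 'I_n => (k <= m) && (v m <? 0)%Z)) => [m /andP[km vm]|v0].
  apply: (Pflip v m) => //; apply: IH; last exact: admissible_flip.
  move/Z.ltb_spec0: vm => vm; rewrite sumf_upd.
  have [-> ->] : f (v m) = (- 2 * v m)%Z /\ f (- v m)%Z = 0%Z by rewrite /f; lia.
  by lia.
apply: P0 => // m km; have := v0 m; rewrite km /=.
by case: Z.ltb_spec.
Qed.

Section Step.
Variable K : Z.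
Hypothesis lowK : low K.

(** After sign changes a decreasing move subtracts twice a smaller positive coordinate, and so does
    the move chosen by [next]; [equiv_descent] compares them. *)
Lemma equiv_decreasing v e (i j : 'I_n) : admissible v ->
  k <= i -> k <= j -> i != j -> norm v = K ->
  (norm (transv e i j v) < norm v)%Z -> equiv v (Sg e i j).
Proof.
move=> adm; move: v adm e.
apply: nonneg_ind => [v adm v0|v m km adm IH] e ki kj ij nv lt.
  have vi := v0 i ki; have vj := v0 j kj.
  have [-> ltij] : e = false /\ (0 < v j < v i)%Z.
    move: lt; rewrite norm_transv /signz; case: e; first by lia.
    by split=> //; lia.
  have := equiv_next adm; case: (nextP adm) => [v00|e0 p q kp kq pq pqk ltpq vq ->] E.
    have [ik|ik] := eqVneq i k.
      have kj' : k < j by rewrite ltn_neqAle kj -ik andbT.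
      by have := v00 _ kj'; lia.
    have ki' : k < i by rewrite ltn_neqAle ki eq_sym ik.
    by have := v00 _ ki'; lia.
  have vp := v0 p kp; have vq0 := v0 q kq.
  have pq0 : (v p * v q <? 0)%Z = false by apply/Z.ltb_ge; nia.
  apply: (equiv_descent lowK adm _ (p := p) (q := q)) => //; try lia.
  by apply: E; rewrite pq0.
apply: (equiv_conj_flip km) => //.
by apply: IH => //; rewrite ?transv_flip // !norm_flip.
Qed.

(** At a nonnegative vector such a move either has source coordinate 0 and fixes the vector, or it
    joins two equal positive coordinates and only changes a sign. *)
Lemma equiv_level v e (i j : 'I_n) : admissible v ->
  k <= i -> k <= j -> i != j -> norm v = K ->
  norm (transv e i j v) = norm v -> equiv v (Sg e i j).
Proof.
move=> adm; move: v adm e.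
apply: nonneg_ind => [v adm v0|v m km adm IH] e ki kj ij nv lt; last first.
  apply: (equiv_conj_flip km) => //.
  by apply: IH => //; rewrite ?transv_flip // !norm_flip.
have vi := v0 i ki; have vj := v0 j kj.
have [[a va] ev] := adm.
have fixed f (x : 'I_n) (u : vec n) : x != j -> u j = 0%Z -> transv f x j u = u.
  move=> xj uj; apply: funext => l; rewrite transvE uj; case: eqP => // ->; lia.
have [vj0|[ef vij vjp]] : v j = 0%Z \/ [/\ e = false, v i = v j & (0 < v j)%Z].
  move: lt; rewrite norm_transv /signz; case: e; first by lia.
  move=> lt; have [->|[]] : v j = 0%Z \/ v i = v j /\ (0 < v j)%Z by lia.
    by left.
  by right.
- have jk : j != k by apply/eqP => jk; move: vj0; rewrite jk; lia.
  case E: (next v) => [[[e0 p] q]|]; last first.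
    move=> x; rewrite rho_Sg // fixed // !(coset_endE _ E); apply: iff_sym.
    apply: (word_mulr stab_gen_inv); apply: word_gen; left.
    by exists e, i, j.
  have Eu := equiv_next adm E; have ltu := norm_next adm E.
  have [kp kq pq _ [ltpq vq _]] := next_some adm E.
  have [jp jq] : j != p /\ j != q by split; apply/eqP => jE; subst j; lia.
  have uj : transv e0 p q v j = 0%Z by rewrite transvE (negPf jp).
  set u := transv e0 p q v in ltu uj.
  have fix_u f (x : 'I_n) : k <= x -> x != j ->
      equiv u (Sg f x j) /\ rho (Sg f x j) u = u.
    move=> kx xj; rewrite rho_Sg // fixed //; split=> //.
    by apply: lowK; rewrite ?fixed -?nv //; exact: admissible_transv.
  (* The move is a loop at [v]. The chosen descent conjugates it to a loop [w] at [u], a product of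
     moves with source [j]; these fix [u] because [u j = 0], and [low] applies to them. *)
  suff [w Ew [uw fixw]] : exists2 w, Sg e i j = (Sg e0 p q)^-1 * (w * Sg e0 p q) &
      equiv u w /\ rho w u = u.
    rewrite Ew; apply: equivM; first by apply: equivM; rewrite ?rho_Sg.
    by rewrite (rhoM sys) rho_Sg // fixw /u -(rho_Sg _ _ pq); apply: equivV.
  have [iq|iq] := eqVneq i q; last first.
    exists (Sg e i j); last exact: fix_u.
    apply: (mulgI (Sg e0 p q)); rewrite mulVKg.
    have [ip|ip] := eqVneq i p; first by subst i; apply: Sg_target.
    by apply: Sg_disjoint; rewrite // eq_sym.
  subst i; exists (Sg (e0 == e) p j * Sg (e0 == e) p j * Sg e q j).
    by apply: (mulgI (Sg e0 p q)); rewrite mulVKg -Sg_chain // eq_sym.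
  have pj : p != j by rewrite eq_sym.
  have [[E1 F1] [E2 F2]] := (fix_u e q kq ij, fix_u (e0 == e) p kp pj).
  rewrite !(rhoM sys) F1 F2 F2; split=> //.
  by apply: equivM => //; apply: equivM; rewrite ?F1 // F2.
subst e.
have [ik jk] : i != k /\ j != k.
  split; apply/eqP => ik.
    have /ev[b] : j != k by rewrite -ik eq_sym.
    by rewrite -vij ik; lia.
  have /ev[b] : i != k by rewrite -ik.
  by rewrite vij ik; lia.
have [b vb] := ev j jk.
have [E1 [E2 [E3 [E4 [E5 E6]]]]] : (i == k) = false /\ (j == k) = false /\
    (i == j) = false /\ (k == i) = false /\ (k == j) = false /\ (j == i) = false.
  by rewrite !(eq_sym k) !(eq_sym j i) !(negPf ij, negPf ik, negPf jk).
have vk := v0 k (leqnn k).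
(* Here [v k] is odd and positive and [v j] is even. If [v k] is the smaller one, [(i, j, k)] is a
   chain; otherwise the commuting move [(k, j)] lowers the norm first. *)
have [lt1|lt1] : (v k < v j \/ v j < v k)%Z by lia.
  apply/(equiv_chain lowK (p := i) (q := j) (r := k)) => //; try lia.
    apply: equiv_decreasing => //; [adm_tac | by rewrite lt | norm_lia].
  by apply: equiv_decreasing => //; norm_lia.
have kj' : k != j by rewrite eq_sym.
have c := Sg_source false false ij kj'.
have -> : Sg false i j = (Sg false k j)^-1 * (Sg false i j * Sg false k j).
  by rewrite c mulKg.
apply: equivM; last first.
  rewrite c (rhoM sys) (rho_Sg _ _ ij); apply: equivV.
  by apply: equiv_decreasing; rewrite // ?lt //; [adm_tac | norm_lia].
apply: equivM; first by apply: equiv_decreasing => //; norm_lia.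
by rewrite rho_Sg //; apply: lowK => //; [adm_tac | norm_lia | norm_lia].
Qed.

End Step.

Lemma low_all N : low (Z.of_nat N).
Proof.
elim: N => [|N lowN] e i j u ki kj ij adm ltu ltt.
  by have := norm_ge0 u; lia.
have step f w : admissible w -> norm w = Z.of_nat N ->
    (norm (transv f i j w) <= norm w)%Z -> equiv w (Sg f i j).
  move=> admw nw le.
  have [lt|eqn] : (norm (transv f i j w) < norm w \/
      norm (transv f i j w) = norm w)%Z by lia.
    exact: (equiv_decreasing lowN).
  exact: (equiv_level lowN).
have [lt1|eq1] : (norm u < Z.of_nat N \/ norm u = Z.of_nat N)%Z by lia.
  have [lt2|eq2] : (norm (transv e i j u) < Z.of_nat N \/
      norm (transv e i j u) = Z.of_nat N)%Z by lia.
    exact: lowN.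
  (* Only the end of the move reaches the new norm, so the inverse move is decreasing. *)
  have : equiv (transv e i j u) (Sg (~~ e) i j).
    by apply: step; rewrite ?transvK //; [adm_tac | lia].
  by move/equivV; rewrite rho_Sg // transvK // SgV negbK.
by apply: step => //; lia.
Qed.

Lemma equiv_Sg v e (i j : 'I_n) : k <= i -> k <= j -> i != j -> admissible v ->
  equiv v (Sg e i j).
Proof.
move=> ki kj ij adm.
apply: (@low_all (Z.to_nat (norm v + norm (transv e i j v))).+1) => //;
  have := norm_ge0 v; have := norm_ge0 (transv e i j v); lia.
Qed.

End Stabilizer.

(** * Faithfulness, by induction on the coordinates involved *)

Definition level_gen (m : nat) (g : Q) : Prop :=
  (exists e (i j : 'I_n), [/\ m <= i, m <= j, i != j & g = Sg e i j])
  \/ exists2 i : 'I_n, m <= i & g = D i.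

(** Every letter preserves the chosen cosets, hence so does [g]. At [unit_vec k] the chosen coset is
    [stab] itself; it contains 1, hence also [g]. *)
Lemma stabilizerP (k : 'I_n) g : word_in (level_gen k) g ->
  rho g (unit_vec k) = unit_vec k -> word_in (stab_gen k) g.
Proof.
move=> wg fixg.
have Eg v : admissible k v -> admissible k (rho g v) /\ equiv k v g.
  move=> adm; elim: wg {fixg} => [|a h ga _ [admh Eh]].
    by split; [rewrite (rho1 sys) | move=> q; rewrite (rho1 sys) mulg1].
  rewrite (rhoM sys); case: ga => [[e [i [j [ki kj ij ->]]]]|[i ki ->]].
    rewrite rho_Sg //; split; first exact: admissible_transv.
    by apply: equivM => //; apply: equiv_Sg.
  rewrite (rho_sign sys); split; first exact: admissible_flip.
  by apply: equivM => //; apply: equiv_flip.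
have adm : admissible k (unit_vec k).
  split=> [|j jk]; rewrite /unit_vec ?eqxx ?(negPf jk); exists 0%Z; lia.
have E : next k (unit_vec k) = None.
  case E: next => [[[e p] q]|//].
  have [kp kq pq pqk [lt nz _]] := next_some adm E.
  move: lt nz pq pqk; rewrite /unit_vec.
  by case: eqP => [->|] //; case: eqP => [->|]; rewrite ?eqxx.
have [_ /(_ 1)] := Eg _ adm; rewrite fixg mul1g !(coset_endE _ E) => -[+ _].
by apply; constructor.
Qed.

Definition row_gen (k : 'I_n) (m : nat) (g : Q) : Prop :=
  exists e (j : 'I_n), [/\ k < j, m <= j & g = Sg e k j].

Lemma level_coord m h v (i : 'I_n) : word_in (level_gen m) h -> i < m ->
  rho h v i = v i.
Proof.
move=> wh im; elim: wh => [|a g ga _ IH]; first by rewrite (rho1 sys).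
have im' (j : 'I_n) : m <= j -> i == j = false.
  by move=> mj; apply/negbTE; rewrite neq_ltn (leq_trans im mj).
rewrite (rhoM sys); case: ga => [[e [j [l [mj _ jl ->]]]]|[j mj ->]].
  by rewrite rho_Sg // transvE im'.
by rewrite (rho_sign sys) flipE im'.
Qed.

Lemma level_fix m h v : word_in (level_gen m) h ->
  (forall j : 'I_n, m <= j -> v j = 0%Z) -> rho h v = v.
Proof.
move=> wh v0; elim: wh => [|a g ga _ IH]; first by rewrite (rho1 sys).
rewrite (rhoM sys) IH; apply: funext => l.
case: ga => [[e [j [i [mj mi ji ->]]]]|[j mj ->]].
  by rewrite rho_Sg // transvE (v0 i) //; case: eqP => // ->; lia.
by rewrite (rho_sign sys) flipE (v0 j) //; case: eqP => // ->; rewrite v0.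
Qed.

Lemma row_coord (k : 'I_n) m a v (i : 'I_n) : word_in (row_gen k m) a -> i != k ->
  rho a v i = v i.
Proof.
move=> wa ik; elim: wa => [|b g [e [j [kj _ ->]]] _ IH]; first by rewrite (rho1 sys).
by rewrite (rhoM sys) rho_Sg ?transvE ?(negPf ik) // neq_ltn kj.
Qed.

Lemma row_fix (k : 'I_n) m a v : word_in (row_gen k m) a ->
  (forall j : 'I_n, k < j -> m <= j -> v j = 0%Z) -> rho a v = v.
Proof.
move=> wa v0; elim: wa => [|b g [e [j [kj mj ->]]] _ IH]; first by rewrite (rho1 sys).
rewrite (rhoM sys) IH rho_Sg ?neq_ltn ?kj //; apply: funext => l.
by rewrite transvE (v0 j) //; case: eqP => // ->; lia.
Qed.

Lemma rho_S_pow (k j : 'I_n) p v : k != j ->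
  rho (S k j ^+ p) v k = (v k + 2 * Z.of_nat p * v j)%Z /\
  forall i, i != k -> rho (S k j ^+ p) v i = v i.
Proof.
move=> kj; elim: p => [|p [IH1 IH2]].
  by rewrite expg0 (rho1 sys); split=> //; lia.
rewrite expgS (rhoM sys) (rho_elem sys) //; split=> [|i ik]; rewrite transvE ?eqxx.
  by rewrite IH1 (IH2 j) 1?eq_sym //; rewrite /signz; lia.
by rewrite (negPf ik) IH2.
Qed.

(** The letters [S k m] commute with the row. Positive ones are collected on the right-hand side and
    inverse ones on the left, so that natural exponents suffice. *)
Lemma row_strip (k m : 'I_n) a : k < m -> word_in (row_gen k m) a ->
  exists p q b, word_in (row_gen k m.+1) b /\ S k m ^+ q * a = S k m ^+ p * b.
Proof.
move=> km; have nkm : k != m by rewrite neq_ltn km.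
elim=> [|x g [e [j [kj mj ->]]] _ [p [q [b [wb E]]]]].
  by exists 0, 0, 1; split=> //; constructor.
have nkj : k != j by rewrite neq_ltn kj.
have c f i : k != i -> S k m ^+ f * Sg e k i = Sg e k i * S k m ^+ f.
  move=> ki; apply/commute_sym/commuteX; apply: (Sg_target e true) => //.
case: (eqVneq j m) => [->|jm].
  case: e c => c.
    exists p.+1, q, b; split=> //; rewrite mulgA c // -mulgA E.
    by rewrite expgS -mulgA.
  exists p, q.+1, b; split=> //; rewrite expgSr -mulgA mulVKg.
  exact: E.
exists p, q, (Sg e k j * b); split; last by rewrite !mulgA !c // -!mulgA E.
constructor=> //; exists e, j; split=> //.
by rewrite ltn_neqAle mj eq_sym jm.
Qed.

(** The columns are stripped one by one: the matrix entry at [(k, m)] is [2 * (p - q)], so a trivial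
    action forces [p = q] and the powers cancel. *)
Lemma row_faithful (k : 'I_n) a : word_in (row_gen k 0) a ->
  (forall i, rho a (unit_vec i) = unit_vec i) -> a = 1.
Proof.
move=> wa fixa.
suff H m : m <= n -> word_in (row_gen k m) a.
  elim: (H n (leqnn n)) => // x g [e [j [_ nj _]]].
  by have := ltn_ord j; rewrite ltnNge nj.
elim: m => [|m IH] lt //.
have {IH} wb := IH (ltnW lt); pose M := Ordinal lt.
have [km|mk] := ltnP k M; last first.
  elim: wb {fixa wa} => [|x g [e [j [kj mj ->]]] _ wg]; first by constructor.
  by constructor=> //; exists e, j; rewrite (leq_ltn_trans mk kj).
have [p [q [c [wc E]]]] := row_strip km wb.
have nkm : k != M by rewrite neq_ltn km.
have cM : rho c (unit_vec M) = unit_vec M.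
  apply: (row_fix wc) => j kj mj; rewrite /unit_vec; case: eqP => // jM.
  by rewrite jM ltnn in mj.
have := congr1 (fun x => rho x (unit_vec M) k) E.
rewrite !(rhoM sys) fixa cM !(rho_S_pow _ _ nkm).1 /unit_vec eqxx => pq.
have {}pq : p = q by lia.
by rewrite pq in E; rewrite (mulgI _ _ _ E).
Qed.

(** A sign at most inverts a row letter. A transvection commutes with it unless its target is the
    source of the row letter; then [Sg_chain] gives a correction inside the row. *)
Lemma row_conj (k : 'I_n) x a : x = D k \/ level_gen k.+1 x ->
  word_in (row_gen k 0) a -> exists2 b, word_in (row_gen k 0) b & x * a = b * x.
Proof.
move=> gx; elim=> [|y g [f [l [kl _ ->]]] _ [b wb E]].
  by exists 1; [constructor | rewrite mulg1 mul1g].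
suff [c wc Ec] : exists2 c, word_in (row_gen k 0) c & x * Sg f k l = c * x.
  exists (c * b); first exact: word_mul.
  by rewrite mulgA Ec -mulgA E mulgA.
have row1 e (j : 'I_n) : k < j -> word_in (row_gen k 0) (Sg e k j).
  by move=> kj; apply: word_gen; exists e, j.
have nk (j : 'I_n) : k < j -> k != j by rewrite neq_ltn => ->.
have conjD m : exists2 c, word_in (row_gen k 0) c & D m * Sg f k l = c * D m.
  exists (Sg (f (+) ((m == k) || (m == l))) k l); first exact: row1.
  by rewrite -sign_Sg ?nk // -!mulgA sign_sq mulg1.
case: gx => [->|[[e [i [j [ki kj ij ->]]]]|[m _ ->]]] //.
have [il|il] := eqVneq i l.
  subst l; exists (Sg (~~ (f == e)) k j * (Sg (~~ (f == e)) k j * Sg f k i)).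
    by do 2?apply: word_mul; apply: row1.
  rewrite -SgV -!mulgA Sg_chain ?nk // -!mulgA !mulKg.
  by [].
exists (Sg f k l); first exact: row1.
have [jl|jl] := eqVneq j l.
  by subst l; rewrite Sg_source ?nk.
by rewrite Sg_disjoint ?nk //; rewrite eq_sym nk.
Qed.

(** As in an affine group, the row [k] plays the part of the translations: [row_conj] moves it to
    the left, and [D k] commutes with the letters of higher index. *)
Lemma stab_split (k : 'I_n) g : word_in (stab_gen k) g ->
  exists a h (c : bool), [/\ word_in (row_gen k 0) a, word_in (level_gen k.+1) h &
    g = a * h * (if c then D k else 1)].
Proof.
have above (j : 'I_n) : k <= j -> j != k -> k < j.
  by move=> kj jk; rewrite ltn_neqAle eq_sym jk.
have Dk h : word_in (level_gen k.+1) h -> D k * h = h * D k.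
  elim=> [|y {}h gy _ E]; first by rewrite mulg1 mul1g.
  rewrite mulgA -[RHS]mulgA -E mulgA; congr (_ * _).
  case: gy => [[e [i [j [ki kj ij ->]]]]|[i _ ->]]; last exact: (signC sys).
  apply: (mulIg (D k)); rewrite sign_Sg // -mulgA sign_sq mulg1.
  have [-> ->] : (k == i) = false /\ (k == j) = false.
    by split; apply/negbTE; rewrite neq_ltn ?ki ?kj.
  by rewrite addbF.
elim=> [|x {}g gx _ [a [h [c [wa wh ->]]]]].
  by exists 1, 1, false; rewrite !mulg1; split=> //; constructor.
have shift : x = D k \/ level_gen k.+1 x -> exists2 b, word_in (row_gen k 0) b &
    x * (a * h * (if c then D k else 1)) = b * (x * h * (if c then D k else 1)).
  by move=> /row_conj/(_ wa)[b wb E]; exists b; rewrite // !mulgA E.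
have keep : level_gen k.+1 x -> exists a' h' (c' : bool),
    [/\ word_in (row_gen k 0) a', word_in (level_gen k.+1) h' &
     x * (a * h * (if c then D k else 1)) = a' * h' * (if c' then D k else 1)].
  move=> lx; have [|b wb ->] := shift; first by right.
  by exists b, (x * h), c; rewrite -!mulgA; split=> //; constructor.
case: gx => [[e [i [j [ki kj ij jk xE]]]]|[i ki xE]].
  have [ik|ik] := eqVneq i k.
    exists (x * a), h, c; rewrite -!mulgA; split=> //; constructor=> //.
    by exists e, j; rewrite xE ik above.
  by apply: keep; left; exists e, i, j; rewrite !above.
have [ik|ik] := eqVneq i k; last by apply: keep; right; exists i; rewrite ?above.
subst i; have [|b wb ->] := shift; first by left.
exists b, h, (~~ c); split=> //; rewrite xE (Dk _ wh) -!mulgA; congr (_ * (_ * _)).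
by case: c {keep shift}; rewrite /= ?mulg1 ?sign_sq.
Qed.

(** Split [g] as in [stab_split]. The sign is excluded by coordinate [k] of the image of
    [unit_vec k]. The row factor changes only coordinate [k], which [h] leaves alone, so [h] acts
    trivially and is 1 by induction; then [row_faithful] applies. *)
Theorem level2_faithful g : word_in (level_gen 0) g ->
  (forall i, rho g (unit_vec i) = unit_vec i) -> g = 1.
Proof.
suff H d m : m + d = n -> forall g, word_in (level_gen m) g ->
    (forall i, rho g (unit_vec i) = unit_vec i) -> g = 1.
  exact: (H n 0).
elim: d m => [|d IH] m mn {}g wg fixg.
  elim: wg {fixg} => // a h ga _ _; exfalso; rewrite addn0 in mn.
  case: ga => [[e [i [_ [ki _ _ _]]]]|[i ki _]];
    by have := leq_ltn_trans ki (ltn_ord i); rewrite mn ltnn.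
have lt : m < n by rewrite -mn -addSnnS leq_addr.
pose k := Ordinal lt; have kE : (k : nat) = m by [].
have [|a [h [c [wa wh gE]]]] := @stab_split k g; first exact: stabilizerP.
have below (v : vec n) : (forall j : 'I_n, k < j -> v j = 0%Z) -> rho (a * h) v = v.
  move=> v0; rewrite (rhoM sys) (level_fix wh) ?(row_fix wa) // => j kj _.
  exact: v0.
have c0 : c = false.
  case: c gE => // gE; have := congr1 (fun v => v k) (fixg k).
  rewrite gE (rhoM sys) (rho_sign sys) below ?flipE /unit_vec ?eqxx // => j kj.
  by rewrite flipE /unit_vec eqxx; case: eqP => // jk; rewrite jk ltnn in kj.
rewrite c0 mulg1 in gE; have fixh i : rho h (unit_vec i) = unit_vec i.
  apply: funext => j; have [->|jk] := eqVneq j k; first exact: (level_coord _ wh).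
  by rewrite -(row_coord _ wa jk) -(rhoM sys) -gE fixg.
have h1 : h = 1 by apply: (IH m.+1) => //; rewrite addSnnS.
rewrite gE h1 mulg1; apply: (row_faithful wa) => i.
by rewrite -[in LHS](fixh i) -(rhoM sys) -gE fixg.
Qed.

End PeakReduction.

(** * Morphisms and reversal on free groups *)

Section FreeGroupTheory.
Variable n : nat.
Local Notation F := (free n).

Definition letter_elt (l : letter n) : F := if l.2 then gen l.1 else (gen l.1)^-1.

Lemma wordM (u w : seq (letter n)) : word (u ++ w) = word u * word w.
Proof. by apply: val_inj; rewrite /= reduce_catr reduce_catl. Qed.

Lemma word1 : word [::] = 1 :> F. Proof. by []. Qed.

Lemma word_letter l : word [:: l] = letter_elt l.
Proof. by case: l => i []; apply: val_inj. Qed.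

Lemma word_cons_elt l w : word (l :: w) = letter_elt l * word w.
Proof. by rewrite -cat1s wordM word_letter. Qed.

Lemma free_ind (P : F -> Prop) :
  P 1 -> (forall l g, P g -> P (letter_elt l * g)) -> forall g, P g.
Proof.
move=> P1 Pl g; rewrite -(wordK g); elim: (fword g) => [|l w IH]; first exact: P1.
by rewrite word_cons_elt; apply: Pl.
Qed.

Section Morphisms.
Variable G : groupType.

Definition is_morphism (f : F -> G) := {morph f : x y / x * y}.

Lemma morphism1 f : is_morphism f -> f 1 = 1.
Proof. by move=> fM; apply: (mulgI (f 1)); rewrite -fM !mulg1. Qed.

Lemma morphismV f x : is_morphism f -> f x^-1 = (f x)^-1.
Proof. by move=> fM; apply/esym/mulg1_eq; rewrite -fM mulgV morphism1. Qed.

Lemma morphism_ext f h : is_morphism f -> is_morphism h ->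
  (forall i, f (gen i) = h (gen i)) -> f =1 h.
Proof.
move=> fM hM fh; apply: free_ind => [|l g E]; first by rewrite !morphism1.
by rewrite fM hM E /letter_elt; case: l.2; rewrite ?morphismV // fh.
Qed.

Variable f : 'I_n -> G.

Definition eval_letter (l : letter n) : G := if l.2 then f l.1 else (f l.1)^-1.

Definition eval_word (w : seq (letter n)) : G :=
  foldr (fun l g => eval_letter l * g) 1 w.

Lemma eval_word_cat u w : eval_word (u ++ w) = eval_word u * eval_word w.
Proof. by elim: u => [|l u IH] /=; rewrite ?mul1g // IH mulgA. Qed.

Lemma eval_letterV l : eval_letter (linv l) = (eval_letter l)^-1.
Proof. by case: l => i []; rewrite /eval_letter /= ?invgK. Qed.

Lemma eval_word_reduce w : eval_word (reduce w) = eval_word w.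
Proof.
elim: w => //= l w <-; case: (reduce w) => //= m w'; case: eqP => // ->.
by rewrite eval_letterV mulKg.
Qed.

Definition lift (g : F) : G := eval_word (fword g).

Lemma liftM : is_morphism lift.
Proof. by move=> x y; rewrite /lift /= eval_word_reduce eval_word_cat. Qed.

Lemma lift_gen i : lift (gen i) = f i.
Proof. by rewrite /lift /= mulg1. Qed.

End Morphisms.

Lemma frevM (x y : F) : frev (x * y) = frev y * frev x.
Proof.
by rewrite -[in LHS](wordK x) -[in LHS](wordK y) -wordM frev_word rev_cat wordM.
Qed.

Lemma frevK : involutive (@frev n).
Proof. by move=> x; rewrite -[in LHS](wordK x) !frev_word revK wordK. Qed.

Lemma frev_gen (i : 'I_n) : frev (gen i) = gen i. Proof. by []. Qed.

Lemma frevV (x : F) : frev x^-1 = (frev x)^-1.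
Proof. by apply/esym/mulg1_eq; rewrite -frevM mulVg. Qed.

(** The reverse of a reduced word is reduced, so the reduced word of an element fixed by [frev] is a
    palindrome. *)
Lemma palindromeP (x : F) : is_palindrome x <-> frev x = x.
Proof.
split=> [[w [rw <-]]|xr]; first by rewrite frev_word rw.
have E : fword x = reduce (rev (fword x)) by rewrite -{1}xr.
exists (fword x); split; last exact: wordK.
have red : reduced (rev (fword x)).
  rewrite /reduced rev_sorted; have : reduced (fword x) by case: (x).
  apply: sub_sorted => k l; rewrite -{1}[k]linvK eq_sym.
  by apply: contra => /eqP->.
by rewrite {2}E reduce_id.
Qed.

(** Conjugating [phi] by reversal gives a morphism again, and it suffices to compare the two on
    generators. In this form closure under products and inverses is immediate. *)
Lemma palindromic_frev (phi : aut F) :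
  palindromic_aut phi <-> forall g, frev (phi g) = phi (frev g).
Proof.
split=> [pal|h i]; last by apply/palindromeP; rewrite h frev_gen.
pose f g := frev (phi (frev g)).
suff E : f =1 phi by move=> g; rewrite -E /f !frevK.
apply: morphism_ext; [|exact: autM|] => [x y|i].
  by rewrite /f frevM autM frevM.
by rewrite /f frev_gen; apply/palindromeP/pal.
Qed.

Lemma palindromic1 : palindromic_aut (1 : aut F).
Proof. exact/palindromic_frev. Qed.

Lemma palindromicM (phi psi : aut F) :
  palindromic_aut phi -> palindromic_aut psi -> palindromic_aut (phi * psi).
Proof.
move=> /palindromic_frev p1 /palindromic_frev p2; apply/palindromic_frev => g.
by rewrite /= -p2 -p1.
Qed.

Lemma palindromicV (phi : aut F) : palindromic_aut phi -> palindromic_aut phi^-1.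
Proof.
move=> /palindromic_frev p; apply/palindromic_frev => g.
by apply: (can_inj (autK phi)); rewrite -p /= !autVK.
Qed.

End FreeGroupTheory.

Local Open Scope classical_set_scope.

HB.instance Definition _ := Monoid.isMulLaw.Build Z 0%Z Z.mul Z.mul_0_l Z.mul_0_r.
HB.instance Definition _ :=
  Monoid.isAddLaw.Build Z Z.mul Z.add Z.mul_add_distr_r Z.mul_add_distr_l.

(** * The palindromic Torelli group *)

Section Generated.
Variables (G : groupType) (A : set G).

Lemma generated_is_subgroup : is_subgroup (generated A).
Proof.
split=> [M [[M1 _ _] _] //|x y Ax Ay M MA|x Ax M MA].
  by case: (MA) => -[_ MM _] _; apply: MM; [exact: Ax | exact: Ay].
by case: (MA) => -[_ _ MV] _; apply: MV; exact: Ax.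
Qed.

Lemma sub_generated : A `<=` generated A.
Proof. by move=> x Ax M [_]; apply. Qed.

Lemma generated_min (H : set G) : is_subgroup H -> A `<=` H -> generated A `<=` H.
Proof. by move=> sH AH x; apply; split. Qed.

End Generated.

Section Derived.
Variable G : groupType.
Implicit Types x y : G.

Lemma derived1 : @derived G 1.
Proof. by case: (generated_is_subgroup [set c : G | exists g h, c = comm g h]). Qed.

Lemma derivedM x y : derived x -> derived y -> derived (x * y).
Proof.
by case: (generated_is_subgroup [set c : G | exists g h, c = comm g h]) => _ + _; apply.
Qed.

Lemma derivedV x : derived x -> derived x^-1.
Proof.
by case: (generated_is_subgroup [set c : G | exists g h, c = comm g h]) => _ _; apply.
Qed.

Lemma derived_comm x y : derived (comm x y).
Proof. by apply: sub_generated; exists x, y. Qed.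

Lemma derived_conj x y : derived x -> derived (y * x * y^-1).
Proof.
move=> dx; have -> : y * x * y^-1 = comm y x * x by rewrite /comm mulgVK.
by apply: derivedM => //; exact: derived_comm.
Qed.

Lemma aut_map1 (phi : aut G) : phi 1 = 1.
Proof. by apply: (mulgI (phi 1)); rewrite -autM !mulg1. Qed.

Lemma aut_mapV (phi : aut G) x : phi x^-1 = (phi x)^-1.
Proof. by apply/esym/mulg1_eq; rewrite -autM mulgV aut_map1. Qed.

Lemma aut_mulE (phi psi : aut G) x : (phi * psi) x = phi (psi x).
Proof. by []. Qed.

Lemma aut_oneE x : (1 : aut G) x = x.
Proof. by []. Qed.

Lemma aut_VE (phi : aut G) x y : phi x = y -> phi^-1 y = x.
Proof. by move<-; exact: autK. Qed.

Lemma derived_aut (phi : aut G) x : derived x -> derived (phi x).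
Proof.
suff: @derived G `<=` [set x | derived (phi x)] by apply.
apply: generated_min => [|_ [g [h ->]]] /=.
  split=> [|y z dy dz|y dy] /=.
  - by rewrite aut_map1; exact: derived1.
  - by rewrite autM; exact: derivedM.
  - by rewrite aut_mapV; exact: derivedV.
by rewrite /comm !autM !aut_mapV; exact: derived_comm.
Qed.

Definition trivial_on_ab_at (phi : aut G) x := derived (phi x * x^-1).

Lemma trivial_atM phi x y :
  trivial_on_ab_at phi x -> trivial_on_ab_at phi y -> trivial_on_ab_at phi (x * y).
Proof.
move=> dx dy; rewrite /trivial_on_ab_at autM invgM.
have -> : phi x * phi y * (y^-1 * x^-1) =
    (phi x * (phi y * y^-1) * (phi x)^-1) * (phi x * x^-1).
  by rewrite !mulgA mulgVK.
by apply: derivedM => //; exact: derived_conj.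
Qed.

Lemma trivial_atV phi x : trivial_on_ab_at phi x -> trivial_on_ab_at phi x^-1.
Proof.
move=> dx; rewrite /trivial_on_ab_at aut_mapV invgK.
have -> : (phi x)^-1 * x = (phi x)^-1 * (phi x * x^-1)^-1 * (phi x)^-1^-1.
  by rewrite invgM !invgK -!mulgA mulVg mulg1.
by apply: derived_conj; exact: derivedV.
Qed.

Lemma trivial_on_ab1 : trivial_on_abelianisation (1 : aut G).
Proof. by move=> x; rewrite aut_oneE mulgV; exact: derived1. Qed.

Lemma trivial_on_abM (phi psi : aut G) : trivial_on_abelianisation phi ->
  trivial_on_abelianisation psi -> trivial_on_abelianisation (phi * psi).
Proof.
move=> t1 t2 x; rewrite aut_mulE -[X in derived X](_ :
  (phi (psi x) * (psi x)^-1) * (psi x * x^-1) = _); first exact: derivedM.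
by rewrite mulgA mulgVK.
Qed.

Lemma trivial_on_abV (phi : aut G) :
  trivial_on_abelianisation phi -> trivial_on_abelianisation phi^-1.
Proof.
move=> t x; have := derivedV (t (phi^-1 x)).
by rewrite (autVK phi x) invgM invgK.
Qed.

Lemma trivial_on_ab_conj (phi psi : aut G) :
  trivial_on_abelianisation phi ->
  trivial_on_abelianisation (psi * phi * psi^-1).
Proof.
move=> t x; rewrite !aut_mulE -{2}(autVK psi x) -aut_mapV -autM.
by apply: derived_aut; exact: t.
Qed.

End Derived.

Section Torelli.
Variable n : nat.
Local Notation F := (free n).

Lemma derived_frev (x : F) : derived x -> derived (frev x).
Proof.
suff: @derived F `<=` [set x | derived (frev x)] by apply.
apply: generated_min => [|_ [g [h ->]]] /=.
  split=> [|y z dy dz|y dy] /=; first exact: derived1.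
  - by rewrite frevM; exact: derivedM.
  - by rewrite frevV; exact: derivedV.
rewrite /comm !frevM !frevV.
have -> : (frev h)^-1 * ((frev g)^-1 * (frev h * frev g)) =
    comm (frev h)^-1 (frev g)^-1 by rewrite /comm !invgK !mulgA.
exact: derived_comm.
Qed.

Lemma trivial_on_ab_gens (phi : aut F) :
  (forall i, trivial_on_ab_at phi (gen i)) -> trivial_on_abelianisation phi.
Proof.
move=> h; apply: free_ind => [|l g dg].
  by rewrite aut_map1 mulgV; exact: derived1.
apply: trivial_atM => //; rewrite /letter_elt; case: l.2 => //.
exact: trivial_atV.
Qed.

Lemma torelli_subgroup : is_subgroup (@palindromic_torelli n).
Proof.
split=> [|x y [px tx] [py ty]|x [px tx]].
- by split; [exact: palindromic1 | exact: trivial_on_ab1].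
- by split; [exact: palindromicM | exact: trivial_on_abM].
- by split; [exact: palindromicV | exact: trivial_on_abV].
Qed.

Lemma torelli_conj (phi psi : aut F) : palindromic_aut psi ->
  palindromic_torelli phi -> palindromic_torelli (psi * phi * psi^-1).
Proof.
move=> ps [pp tp]; split; last exact: trivial_on_ab_conj.
by apply: palindromicM; [exact: palindromicM | exact: palindromicV].
Qed.

Definition torelli_gens : set (aut F) :=
  @doubled_commutator_transvection n `|` @separating_pi_twist n.

Lemma pi_basis_image (psi : aut F) Y : palindromic_aut psi -> is_pi_basis Y ->
  is_pi_basis (psi @` Y).
Proof.
move=> ps [phi pp ->]; exists (psi * phi); first exact: palindromicM.
exact: image_comp.
Qed.

(** The conjugate has the same shape with respect to the image of the pi-basis under [psi], because
    [psi] commutes with [frev]. *)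
Lemma torelli_gens_conj (phi psi : aut F) : palindromic_aut psi ->
  torelli_gens phi -> torelli_gens (psi * phi * psi^-1).
Proof.
move=> ps; have /palindromic_frev rev_psi := ps; have inj := can_inj (autK psi).
case=> -[tp [Y [bY [y1 [y2 [y3 [[Y1 Y2 Y3] [n12 n13 n23]]]]]]]].
  move=> E1 E; left; split; first exact: torelli_conj.
  exists (psi @` Y); split; first exact: pi_basis_image.
  exists (psi y1), (psi y2), (psi y3); split.
  - by split; [exists y1 | exists y2 | exists y3].
  - by split=> /inj.
  - by rewrite !aut_mulE (aut_VE erefl) E1 !autM -rev_psi /comm !autM !aut_mapV.
  - move=> _ [y Yy <-] ne; rewrite !aut_mulE (aut_VE erefl) E //.
    by move=> yE; apply: ne; rewrite yE.
move=> [E1 E2 E3] E; right; split; first exact: torelli_conj.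
exists (psi @` Y); split; first exact: pi_basis_image.
exists (psi y1), (psi y2), (psi y3); split.
- by split; [exists y1 | exists y2 | exists y3].
- by split=> /inj.
- move=> d; have -> : d = psi (y1^-1 * y2^-1 * y3^-1 * y1 * y2 * y3).
    by rewrite /d !autM !aut_mapV.
  rewrite rev_psi {d}; move: (_ * _ * y1 * y2 * y3) E1 E2 E3 => c E1 E2 E3.
  by split; rewrite !aut_mulE (aut_VE erefl) ?(E1, E2, E3) !autM ?aut_mapV.
- move=> _ [y Yy <-] ne1 ne2 ne3; rewrite !aut_mulE (aut_VE erefl) E //.
  + by move=> yE; apply: ne1; rewrite yE.
  + by move=> yE; apply: ne2; rewrite yE.
  + by move=> yE; apply: ne3; rewrite yE.
Qed.

Definition torelli_sub : set (aut F) := generated torelli_gens.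

Lemma torelli_sub_torelli : torelli_sub `<=` @palindromic_torelli n.
Proof. by apply: generated_min; [exact: torelli_subgroup | move=> x [[]|[]]]. Qed.

Lemma torelli_sub_conj (phi psi : aut F) : palindromic_aut psi ->
  torelli_sub phi -> torelli_sub (psi * phi * psi^-1).
Proof.
move=> ps; move: phi; have [N1 NM NV] := generated_is_subgroup torelli_gens.
suff: torelli_sub `<=` [set phi | torelli_sub (psi * phi * psi^-1)] by [].
apply: generated_min => [|phi gphi] /=; last first.
  by apply: sub_generated; exact: torelli_gens_conj.
split=> [|x y Nx Ny|x Nx] /=.
- by rewrite mulg1 mulgV.
- have -> : psi * (x * y) * psi^-1 = (psi * x * psi^-1) * (psi * y * psi^-1).
    by rewrite !mulgA mulgVK.
  exact: NM.
- have -> : psi * x^-1 * psi^-1 = (psi * x * psi^-1)^-1.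
    by rewrite !invgM invgK mulgA.
  exact: NV.
Qed.

End Torelli.

(** * Elementary palindromic automorphisms *)

Ltac group_norm :=
  rewrite ?invgM ?invgK ?mulgA;
  repeat progress rewrite ?mulgK ?mulgVK ?mulgV ?mulVg ?mul1g ?mulg1.

Section ElementaryMaps.
Variable n : nat.
Local Notation F := (free n).

Lemma aut_gens_ext (phi psi : aut F) :
  (forall i, phi (gen i) = psi (gen i)) -> phi = psi.
Proof. by move=> h; apply/autP/morphism_ext; [exact: autM | exact: autM |]. Qed.

Lemma lift_cancel (f g : 'I_n -> F) :
  (forall i, lift g (f i) = gen i) -> cancel (lift f) (lift g).
Proof.
move=> fg; apply: (@morphism_ext _ _ (lift g \o lift f) id) => [x y|//|i] /=.
  by rewrite !liftM.
by rewrite lift_gen fg.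
Qed.

Lemma letter_eltV (l : letter n) : letter_elt (linv l) = (letter_elt l)^-1.
Proof. by case: l => i []; rewrite /letter_elt /= ?invgK. Qed.

Lemma lift_letter (G : groupType) (f : 'I_n -> G) l :
  lift f (letter_elt l) = eval_letter f l.
Proof.
rewrite /letter_elt /eval_letter; case: l.2; rewrite ?lift_gen //.
by rewrite morphismV ?lift_gen //; exact: liftM.
Qed.

(** For [i = j] this is the identity, so that an automorphism is defined for all pairs of indices.
    The bit [e] covers the inverse by the same formula. *)
Definition elem_map (e : bool) (i j m : 'I_n) : F :=
  if (m == j) && (i != j) then letter_elt (i, e) * gen m * letter_elt (i, e)
  else gen m.

Lemma elem_mapK e i j : cancel (lift (elem_map e i j)) (lift (elem_map (~~ e) i j)).
Proof.
apply: lift_cancel => m; rewrite {2}/elem_map.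
case: andP => [[/eqP -> ij]|h]; last by rewrite lift_gen /elem_map; case: andP.
rewrite !liftM lift_gen lift_letter /eval_letter /= /elem_map (negPf ij) eqxx /=.
by case: e; rewrite /letter_elt /=; group_norm.
Qed.

(* Acts on the abelianisation as the elementary matrix with a 2 in position (i, j). *)
Definition elem_aut (i j : 'I_n) : aut F :=
  Aut (@liftM _ _ _) (elem_mapK true i j) (elem_mapK false i j).

Definition inversion_map (i m : 'I_n) : F := if m == i then (gen m)^-1 else gen m.

Lemma inversion_mapK i : cancel (lift (inversion_map i)) (lift (inversion_map i)).
Proof.
apply: lift_cancel => m; rewrite {2}/inversion_map.
case: (eqVneq m i) => [->|mi]; last by rewrite lift_gen /inversion_map (negPf mi).
rewrite morphismV ?lift_gen /inversion_map ?eqxx ?invgK //; exact: liftM.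
Qed.

Definition inversion_aut i : aut F :=
  Aut (@liftM _ _ _) (inversion_mapK i) (inversion_mapK i).

End ElementaryMaps.

(* Locked, since rewriting with [autM] would otherwise unfold [elem i j (gen k)]. *)
HB.lock Definition elem (n : nat) (i j : 'I_n) := elem_aut i j.
HB.lock Definition inversion (n : nat) (i : 'I_n) := inversion_aut i.

Section Elementary.
Variable n : nat.
Local Notation F := (free n).
Implicit Types i j k l m : 'I_n.

Lemma elem_same i j : (i == j) = false -> elem i j (gen j) = gen i * gen j * gen i.
Proof. by move=> ij; rewrite elem.unlock [LHS]lift_gen /elem_map eqxx ij. Qed.

Lemma elem_other i j m : (m == j) = false -> elem i j (gen m) = gen m.
Proof. by move=> mj; rewrite elem.unlock [LHS]lift_gen /elem_map mj. Qed.

Lemma elemV_same i j : (i == j) = false ->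
  (elem i j)^-1 (gen j) = (gen i)^-1 * gen j * (gen i)^-1.
Proof. by move=> ij; rewrite elem.unlock [LHS]lift_gen /elem_map eqxx ij. Qed.

Lemma elemV_other i j m : (m == j) = false -> (elem i j)^-1 (gen m) = gen m.
Proof. by move=> mj; rewrite elem.unlock [LHS]lift_gen /elem_map mj. Qed.

Lemma inversion_same i : inversion i (gen i) = (gen i)^-1.
Proof. by rewrite inversion.unlock [LHS]lift_gen /inversion_map eqxx. Qed.

Lemma inversion_other i m : (m == i) = false -> inversion i (gen m) = gen m.
Proof. by move=> mi; rewrite inversion.unlock [LHS]lift_gen /inversion_map mi. Qed.

Lemma inversionV i : (inversion i)^-1 = inversion i.
Proof. by rewrite inversion.unlock; exact: autP. Qed.

Lemma elem_palindromic i j : palindromic_aut (elem i j).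
Proof.
move=> m; apply/palindromeP; rewrite elem.unlock [elem_aut i j _]lift_gen /elem_map.
by case: ifP => // _; rewrite !frevM !frev_gen mulgA.
Qed.

Lemma inversion_palindromic i : palindromic_aut (inversion i).
Proof.
move=> m; apply/palindromeP.
rewrite inversion.unlock [inversion_aut i _]lift_gen /inversion_map.
by case: ifP.
Qed.

End Elementary.

Ltac neq_false := repeat match goal with H : is_true (?a != ?b) |- _ =>
  pose proof (negPf H);
  assert ((b == a) = false) by (rewrite eq_sym; exact (negPf H)); clear H end.

Ltac aut_eval := neq_false;
  repeat first
    [ rewrite !aut_mulE | rewrite !autM | rewrite !aut_mapV
    | rewrite !inversion_same
    | match goal with
      | H : (?i == ?j) = false |- _ => rewrite !(elem_same H)
      | H : (?i == ?j) = false |- _ => rewrite !(elemV_same H)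
      | H : (?m == ?j) = false |- context [elem ?i ?j] => rewrite !(elem_other i H)
      | H : (?m == ?j) = false |- context [elem ?i ?j] => rewrite !(elemV_other i H)
      | H : (?m == ?j) = false |- _ => rewrite !(inversion_other H)
      end ].

(** * Relations between the elementary automorphisms *)

Section Relations.
Variable n : nat.
Implicit Types i j k l m : 'I_n.

Lemma elem_target i j k : i != j -> i != k ->
  elem i j * elem i k = elem i k * elem i j.
Proof.
move=> ij ik; have [<- //|jk] := eqVneq j k.
apply: aut_gens_ext => m.
have [->|mj] := eqVneq m j; first by aut_eval.
by have [->|mk] := eqVneq m k; aut_eval.
Qed.

Lemma elem_disjoint i j k l : i != j -> k != l -> i != k -> i != l ->
  j != k -> j != l -> elem i j * elem k l = elem k l * elem i j.
Proof.
move=> ij kl ik il jk jl; apply: aut_gens_ext => m.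
have [->|mj] := eqVneq m j; first by aut_eval.
by have [->|ml] := eqVneq m l; aut_eval.
Qed.

Lemma elem_chain i j k : i != j -> j != k -> i != k ->
  elem i j * elem j k = elem i k * elem j k * elem i k * elem i j.
Proof.
move=> ij jk ik; apply: aut_gens_ext => m.
have [->|mj] := eqVneq m j; first by aut_eval.
have [->|mk] := eqVneq m k; last by aut_eval.
by aut_eval; rewrite !mulgA.
Qed.

Lemma inversionC i j : inversion i * inversion j = inversion j * inversion i.
Proof.
apply: aut_gens_ext => m; have [<- //|ij] := eqVneq i j.
have [->|mi] := eqVneq m i; first by aut_eval.
by have [->|mj] := eqVneq m j; aut_eval.
Qed.

Lemma inversion_elem_target i j : i != j ->
  inversion i * elem i j * inversion i = (elem i j)^-1.
Proof.
move=> ij; apply: aut_gens_ext => m.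
have [->|mj] := eqVneq m j; first by aut_eval; group_norm.
by have [->|mi] := eqVneq m i; aut_eval; group_norm.
Qed.

Lemma inversion_elem_source i j : i != j ->
  inversion j * elem i j * inversion j = (elem i j)^-1.
Proof.
move=> ij; apply: aut_gens_ext => m.
have [->|mj] := eqVneq m j; first by aut_eval; group_norm.
by have [->|mi] := eqVneq m i; aut_eval; group_norm.
Qed.

Lemma inversion_elem_other i j m : i != j -> m != i -> m != j ->
  inversion m * elem i j * inversion m = elem i j.
Proof.
move=> ij mi mj; apply: aut_gens_ext => l.
have [->|lm] := eqVneq l m; first by aut_eval; group_norm.
by have [->|lj] := eqVneq l j; aut_eval; group_norm.
Qed.

Lemma gen_inj i j : gen i = gen j -> i = j.
Proof. by case. Qed.

Lemma pi_basis_gens : is_pi_basis (range (@gen n)).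
Proof.
exists 1; first exact: palindromic1.
by apply/esym; exact: image_id.
Qed.

Lemma derived_sandwich (d x : free n) :
  derived d -> derived (frev d * x * d * x^-1).
Proof.
move=> dd; rewrite -!mulgA (mulgA x); apply: derivedM; first exact: derived_frev.
exact: derived_conj.
Qed.

(** The source of the relation [S_source] in the quotient. *)
Lemma elem_source_dct i j k : i != k -> j != k -> i != j ->
  doubled_commutator_transvection (comm (elem i k) (elem j k)).
Proof.
move=> ik jk ij; pose phi := comm (elem i k) (elem j k).
have phik : phi (gen k) = frev (comm (gen i) (gen j)) * gen k * comm (gen i) (gen j).
  rewrite /phi /comm !(frevM, frevV, frev_gen); aut_eval.
  by group_norm.
have phim m : m != k -> phi (gen m) = gen m.
  by move=> mk; rewrite /phi /comm; aut_eval.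
have pal : palindromic_aut phi.
  by do !apply: palindromicM; try apply: palindromicV; apply: elem_palindromic.
split; first split=> //.
  apply: trivial_on_ab_gens => m; rewrite /trivial_on_ab_at.
  have [->|mk] := eqVneq m k; last by rewrite phim // mulgV; exact: derived1.
  by rewrite phik; apply: derived_sandwich; exact: derived_comm.
exists (range (@gen n)); split; first exact: pi_basis_gens.
exists (gen k), (gen i), (gen j); split.
- by split; [exists k | exists i | exists j].
- by split=> /gen_inj E; move: ik jk ij; rewrite E eqxx.
- exact: phik.
- by move=> _ [m _ <-] mk; apply: phim; apply/eqP => E; apply: mk; rewrite E.
Qed.

(* The pi-basis exhibiting the twist consists of the inverses of the generators
   [k], [j], [i], in this order, and of the other generators. *)
Lemma elem_triangle_spt i j k : i != j -> j != k -> i != k ->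
  let w := elem i j * (elem i k)^-1 * elem k i * elem j i * elem j k * (elem k j)^-1 in
  separating_pi_twist (w * w).
Proof.
move=> ij jk ik w; set x := gen i; set y := gen j; set z := gen k.
have wx : w x = x * y * z * x^-1 * z * y * x.
  by rewrite /w /x /y /z; aut_eval; group_norm.
have wy : w y = x^-1 * y^-1 * z^-1 * y^-1 * z^-1 * y^-1 * x^-1.
  by rewrite /w /x /y /z; aut_eval; group_norm.
have wz : w z = x * y * z * y * x.
  by rewrite /w /x /y /z; aut_eval; group_norm.
have wm m : m != i -> m != j -> m != k -> w (gen m) = gen m.
  by move=> mi mj mk; rewrite /w; aut_eval.
have palw : palindromic_aut w.
  by do !apply: palindromicM; try apply: palindromicV; apply: elem_palindromic.
move: w wx wy wz wm palw => w wx wy wz wm palw.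
pose d := z * y * x * z^-1 * y^-1 * x^-1.
have dd : derived d.
  have -> : d = comm z (y * x) * comm y x by rewrite /d /comm; group_norm.
  by apply: derivedM; exact: derived_comm.
have rd : frev d = x^-1 * y^-1 * z^-1 * x * y * z.
  by rewrite /d !(frevM, frevV) /x /y /z !frev_gen; group_norm.
have px : (w * w) x^-1 = frev d * x^-1 * d.
  by rewrite rd /d aut_mulE !(aut_mapV, wx, autM, wy, wz); group_norm.
have py : (w * w) y^-1 = d^-1 * y^-1 * (frev d)^-1.
  by rewrite rd /d aut_mulE !(aut_mapV, wx, autM, wy, wz); group_norm.
have pz : (w * w) z^-1 = frev d * z^-1 * d.
  by rewrite rd /d aut_mulE !(aut_mapV, wx, autM, wy, wz); group_norm.
have pm m : m != i -> m != j -> m != k -> (w * w) (gen m) = gen m.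
  by move=> mi mj mk; rewrite aut_mulE !wm.
have dV : derived d^-1 by exact: derivedV.
split; first split; first exact: palindromicM.
  apply: trivial_on_ab_gens => m.
  have inv u : trivial_on_ab_at (w * w) u^-1 -> trivial_on_ab_at (w * w) u.
    by move/trivial_atV; rewrite invgK.
  have [->|mi] := eqVneq m i.
    by apply: inv; rewrite /trivial_on_ab_at px; exact: derived_sandwich.
  have [->|mj] := eqVneq m j.
    apply: inv; rewrite /trivial_on_ab_at py -(frevK d) -!frevV.
    have := derived_sandwich y^-1 (derived_frev dV).
    by rewrite !frevV !frevK.
  have [->|mk] := eqVneq m k.
    by apply: inv; rewrite /trivial_on_ab_at pz; exact: derived_sandwich.
  by rewrite /trivial_on_ab_at pm // mulgV; exact: derived1.
pose psi := inversion i * inversion j * inversion k.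
have [psix psiy psiz] : [/\ psi x = x^-1, psi y = y^-1 & psi z = z^-1].
  by rewrite /psi /x /y /z; split; aut_eval.
exists (psi @` range (@gen n)); split.
  exists psi => //; do !apply: palindromicM; exact: inversion_palindromic.
exists z^-1, y^-1, x^-1; split.
- split; [rewrite -psiz | rewrite -psiy | rewrite -psix].
  + by exists z => //; exists k.
  + by exists y => //; exists j.
  + by exists x => //; exists i.
- by split=> /invg_inj/gen_inj E; move: ij jk ik; rewrite E eqxx.
- rewrite !invgK -/d; by split.
move=> _ [_ [m _ <-] <-] nz ny nx.
have [mi mj mk] : [/\ m != i, m != j & m != k].
  by split; apply/eqP => E; [apply: nx | apply: ny | apply: nz]; rewrite E.
have -> : psi (gen m) = gen m by rewrite /psi; aut_eval.
exact: pm.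
Qed.

End Relations.

(** * The action on the abelianisation *)

Section Exponents.
Variable n : nat.
Local Notation F := (free n).

Definition letter_exp (l : letter n) : vec n :=
  fun m => if l.1 == m then signz l.2 else 0%Z.

Definition word_exp (w : seq (letter n)) : vec n :=
  fun m => foldr (fun l s => (letter_exp l m + s)%Z) 0%Z w.

Definition expo (g : F) : vec n := word_exp (fword g).

Lemma word_exp_cat u w m : word_exp (u ++ w) m = (word_exp u m + word_exp w m)%Z.
Proof.
elim: u => [|l u IH] //=.
by rewrite [LHS]/= /word_exp /= -!/(word_exp _ _) ?IH; lia.
Qed.

Lemma letter_expV l m : letter_exp (linv l) m = (- letter_exp l m)%Z.
Proof. by case: l => i []; rewrite /letter_exp /=; case: eqP. Qed.

Lemma word_exp_reduce w m : word_exp (reduce w) m = word_exp w m.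
Proof.
elim: w => //= l w IH; rewrite [RHS]/= /word_exp /= -!/(word_exp _ _) -IH.
case: (reduce w) => //= k w'; case: eqP => [->|] //.
by rewrite /word_exp /= letter_expV; lia.
Qed.

Lemma expoM x y m : expo (x * y) m = (expo x m + expo y m)%Z.
Proof. by rewrite /expo /= word_exp_reduce word_exp_cat. Qed.

Lemma expo1 m : expo 1 m = 0%Z.
Proof. by []. Qed.

Lemma expoV x m : expo x^-1 m = (- expo x m)%Z.
Proof. by have := expoM x x^-1 m; rewrite mulgV expo1; lia. Qed.

Lemma expo_gen (i : 'I_n) : expo (gen i) = unit_vec i.
Proof.
apply: funext => m; rewrite /expo /word_exp /= /letter_exp /unit_vec /= eq_sym.
by case: eqP.
Qed.

Lemma expo_letter l m : expo (letter_elt l) m = letter_exp l m.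
Proof.
case: l => i []; rewrite /letter_elt /= ?expoV expo_gen /letter_exp /unit_vec /= eq_sym;
by case: eqP.
Qed.

Lemma expo_derived g m : derived g -> expo g m = 0%Z.
Proof.
suff: @derived F `<=` [set g | expo g m = 0%Z] by apply.
apply: generated_min => [|_ [x [y ->]]] /=; last by rewrite /comm !(expoM, expoV); lia.
split=> [|x y /= xm ym|x /= xm]; rewrite //= ?expoM ?expoV; lia.
Qed.

Lemma expo_trivial (phi : aut F) g :
  trivial_on_abelianisation phi -> expo (phi g) = expo g.
Proof.
move=> t; apply: funext => m; have := expo_derived m (t g).
by rewrite expoM expoV; lia.
Qed.

(** The matrix of [phi] on the abelianisation applied to [v]; its columns are the exponent sums of
    the images of the generators. *)
Definition act (phi : aut F) (v : vec n) : vec n :=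
  fun m => \big[Z.add/0%Z]_(j < n) (v j * expo (phi (gen j)) m)%Z.

Lemma sum_unit_vec v m : \big[Z.add/0%Z]_(j < n) (v j * unit_vec j m)%Z = v m.
Proof.
rewrite (bigD1 m) //= big1 /unit_vec ?eqxx => [|j jm]; first by lia.
by rewrite eq_sym (negPf jm); lia.
Qed.

Lemma expo_act (phi : aut F) g : expo (phi g) = act phi (expo g).
Proof.
apply: funext => m; move: g; apply: free_ind => [|l g IH].
  by rewrite aut_map1 expo1 /act big1 // => j _; rewrite expo1; lia.
rewrite autM expoM IH /act.
have -> : expo (phi (letter_elt l)) m =
    \big[Z.add/0%Z]_(j < n) (letter_exp l j * expo (phi (gen j)) m)%Z.
  rewrite (bigD1 l.1) //= big1 => [|j jl]; last first.
    by rewrite /letter_exp eq_sym (negPf jl); lia.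
  rewrite /letter_exp eqxx /letter_elt; case: l.2; rewrite ?aut_mapV ?expoV /signz; lia.
by rewrite -big_split; apply: eq_bigr => j _; rewrite expoM expo_letter /=; lia.
Qed.

Lemma actM (phi psi : aut F) v : act (phi * psi) v = act phi (act psi v).
Proof.
apply: funext => m; rewrite /act.
under eq_bigr => j _ do rewrite aut_mulE expo_act /act big_distrr /=.
rewrite exchange_big; apply: eq_bigr => j _ /=; rewrite big_distrl /=.
by apply: eq_bigr => i _; lia.
Qed.

Lemma act_trivial (phi : aut F) v : trivial_on_abelianisation phi -> act phi v = v.
Proof.
move=> t; apply: funext => m; rewrite /act -[RHS]sum_unit_vec.
by apply: eq_bigr => j _; rewrite expo_trivial // expo_gen.
Qed.

Lemma act_elem i j v : i != j -> act (elem i j) v = transv true i j v.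
Proof.
move=> ij; apply: funext => m; rewrite /act (bigD1 j) //= transvE.
rewrite (eq_bigr (fun l => (v l * unit_vec l m)%Z)); last first.
  by move=> l /negPf lj; rewrite elem_other // expo_gen.
have := sum_unit_vec v m; rewrite (bigD1 j) //= elem_same ?(negPf ij) // => E.
rewrite !expoM !expo_gen; move: E; set s := \big[_/_]_(_ | _) _ => E.
by rewrite ![unit_vec i m]/unit_vec /signz; case: eqP => [<-|_]; lia.
Qed.

Lemma act_inversion i v : act (inversion i) v = flip i v.
Proof.
apply: funext => m; rewrite /act (bigD1 i) //= flipE.
rewrite (eq_bigr (fun l => (v l * unit_vec l m)%Z)); last first.
  by move=> l /negPf li; rewrite inversion_other // expo_gen.
have := sum_unit_vec v m; rewrite (bigD1 i) //= inversion_same expoV expo_gen.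
set s := \big[_/_]_(_ | _) _; rewrite /unit_vec.
by case: eqP => [->|_]; lia.
Qed.

End Exponents.

(** * Quotient by a normal subgroup *)

Section Quotient.
Variables (G : groupType) (N : set G).

Definition is_normal : Prop :=
  is_subgroup N /\ forall x y, N x -> N (y * x * y^-1).

Hypothesis norN : is_normal.

Let sN : is_subgroup N. Proof. by case: norN. Qed.
Let nN x y : N x -> N (y * x * y^-1). Proof. by case: norN => _; apply. Qed.

Definition same_coset (x y : G) : bool := `[< N (x * y^-1) >].

Lemma same_coset_refl : reflexive same_coset.
Proof. by move=> x; apply/asboolP; rewrite mulgV; case: sN. Qed.

Lemma same_coset_sym : symmetric same_coset.
Proof.
suff H x y : same_coset x y -> same_coset y x by move=> x y; apply/idP/idP; apply: H.
by move/asboolP => Nxy; apply/asboolP; case: sN => _ _ /(_ _ Nxy); rewrite invgM invgK.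
Qed.

Lemma same_coset_trans : transitive same_coset.
Proof.
move=> y x z /asboolP xy /asboolP yz; apply/asboolP.
by case: sN => _ /(_ _ _ xy yz) + _; rewrite mulgA mulgVK.
Qed.

Canonical same_coset_equiv :=
  EquivRel same_coset same_coset_refl same_coset_sym same_coset_trans.

Definition quotient_group := {eq_quot same_coset_equiv}%qT.
HB.instance Definition _ := Choice.on quotient_group.
HB.instance Definition _ := EqQuotient.on quotient_group.

Definition to_quot (x : G) : quotient_group := (\pi_quotient_group x)%qT.

Lemma to_quotP x y : to_quot x = to_quot y <-> N (x * y^-1).
Proof.
by split=> [/eqmodP/asboolP|h] //; apply/eqmodP/asboolP.
Qed.

Lemma to_quot_ind (P : quotient_group -> Prop) :
  (forall x, P (to_quot x)) -> forall q, P q.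
Proof. by move=> h q; rewrite -[q]reprK; apply: h. Qed.

Definition quot_mul (a b : quotient_group) := to_quot (repr a * repr b).
Definition quot_inv (a : quotient_group) := to_quot (repr a)^-1.

Lemma repr_to_quot x : N (repr (to_quot x) * x^-1).
Proof. by apply/to_quotP; rewrite /to_quot reprK. Qed.

Lemma quot_mulE x y : quot_mul (to_quot x) (to_quot y) = to_quot (x * y).
Proof.
apply/to_quotP; have Nx := repr_to_quot x; have Ny := repr_to_quot y.
set x' := repr _ in Nx *; set y' := repr _ in Ny *.
have -> : x' * y' * (x * y)^-1 = (x' * (y' * y^-1) * x'^-1) * (x' * x^-1).
  by rewrite invgM !mulgA mulgVK.
by case: sN => _ + _; apply=> //; apply: nN.
Qed.

Lemma quot_invE x : quot_inv (to_quot x) = to_quot x^-1.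
Proof.
apply/to_quotP; have Nx := repr_to_quot x; set x' := repr _ in Nx *.
have -> : x'^-1 * x^-1^-1 = x'^-1 * (x' * x^-1)^-1 * x'^-1^-1.
  by rewrite invgM !invgK -!mulgA mulVg mulg1.
by apply: nN; case: sN => _ _; apply.
Qed.

Lemma quot_mulA : associative quot_mul.
Proof.
by elim/to_quot_ind=> x; elim/to_quot_ind=> y; elim/to_quot_ind=> z;
  rewrite !quot_mulE mulgA.
Qed.

Lemma quot_mul1 : left_id (to_quot 1) quot_mul.
Proof. by elim/to_quot_ind=> x; rewrite quot_mulE mul1g. Qed.

Lemma quot_1mul : right_id (to_quot 1) quot_mul.
Proof. by elim/to_quot_ind=> x; rewrite quot_mulE mulg1. Qed.

Lemma quot_mulV : left_inverse (to_quot 1) quot_inv quot_mul.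
Proof. by elim/to_quot_ind=> x; rewrite quot_invE quot_mulE mulVg. Qed.

Lemma quot_Vmul : right_inverse (to_quot 1) quot_inv quot_mul.
Proof. by elim/to_quot_ind=> x; rewrite quot_invE quot_mulE mulgV. Qed.

HB.instance Definition _ :=
  isGroup.Build quotient_group quot_mulA quot_mul1 quot_1mul quot_mulV quot_Vmul.

Lemma to_quotM x y : to_quot (x * y) = to_quot x * to_quot y.
Proof. by rewrite -quot_mulE. Qed.

Lemma to_quotV x : to_quot x^-1 = (to_quot x)^-1.
Proof. by rewrite -quot_invE. Qed.

Lemma to_quot_eq1 x : to_quot x = 1 <-> N x.
Proof. by rewrite -[1]/(to_quot 1) to_quotP invg1 mulg1. Qed.

End Quotient.

(** * The palindromic automorphism group modulo the Torelli generators *)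

Section PalindromicGroup.
Variable n : nat.

(** The palindromic automorphisms get a group type of their own because the quotient is taken there:
    [torelli_sub_conj] conjugates by palindromic automorphisms. *)
Record pal := Pal { pal_aut :> aut (free n); _ : `[< palindromic_aut pal_aut >] }.
HB.instance Definition _ := [isSub for pal_aut].
HB.instance Definition _ := [Choice of pal by <:].

Lemma palP (x : pal) : palindromic_aut x.
Proof. by case: x => x /= /asboolP. Qed.

Definition mk_pal x (px : palindromic_aut x) : pal := Pal (asboolT px).

Definition pal_one := mk_pal (@palindromic1 n).
Definition pal_mul (x y : pal) := mk_pal (palindromicM (palP x) (palP y)).
Definition pal_inv (x : pal) := mk_pal (palindromicV (palP x)).

Lemma pal_mulA : associative pal_mul.
Proof. by move=> x y z; apply: val_inj; exact: mulgA. Qed.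
Lemma pal_1mul : left_id pal_one pal_mul.
Proof. by move=> x; apply: val_inj; exact: mul1g. Qed.
Lemma pal_mul1 : right_id pal_one pal_mul.
Proof. by move=> x; apply: val_inj; exact: mulg1. Qed.
Lemma pal_Vmul : left_inverse pal_one pal_inv pal_mul.
Proof. by move=> x; apply: val_inj; exact: mulVg. Qed.
Lemma pal_mulV : right_inverse pal_one pal_inv pal_mul.
Proof. by move=> x; apply: val_inj; exact: mulgV. Qed.

HB.instance Definition _ :=
  isGroup.Build pal pal_mulA pal_1mul pal_mul1 pal_Vmul pal_mulV.

Definition pal_sub : set pal := [set x | torelli_sub (x : aut (free n))].

Lemma pal_sub_normal : is_normal pal_sub.
Proof.
have [N1 NM NV] := generated_is_subgroup (@torelli_gens n).
split; first by split=> [|x y Nx Ny|x Nx]; [exact: N1 | exact: NM | exact: NV].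
by move=> x y Nx; apply: torelli_sub_conj => //; exact: palP.
Qed.

Local Notation Q := (quotient_group pal_sub_normal).

Definition elem_pal (i j : 'I_n) : pal := mk_pal (elem_palindromic i j).
Definition inversion_pal (i : 'I_n) : pal := mk_pal (inversion_palindromic i).

Definition elem_coset i j : Q := to_quot pal_sub_normal (elem_pal i j).
Definition inversion_coset i : Q := to_quot pal_sub_normal (inversion_pal i).
Definition act_coset (q : Q) : vec n -> vec n := act (repr q : pal).

(** The chosen representative differs from [x] by an element of [torelli_sub], which acts trivially
    on the abelianisation. *)
Lemma act_to_quot (x : pal) v : act_coset (to_quot pal_sub_normal x) v = act x v.
Proof.
rewrite /act_coset; set y := repr _.
have Nyx : pal_sub (y * x^-1) by exact: repr_to_quot.
have -> : y = y * x^-1 * x by rewrite mulgVK.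
rewrite [LHS]actM act_trivial //.
by have [_ t] := torelli_sub_torelli Nyx.
Qed.

(** All group relations except [S_source] and [S_triangle] hold already between the automorphisms.
    These two hold in the quotient because the doubled commutator transvections and the separating
    pi-twists become trivial. *)
Lemma pal_level2_system : level2_system elem_coset inversion_coset act_coset.
Proof.
have quotE (x y : pal) : pal_aut x = pal_aut y ->
    to_quot pal_sub_normal x = to_quot pal_sub_normal y.
  by move=> E; congr to_quot; exact: val_inj.
split.
- move=> v; rewrite -[1]/(to_quot _ 1) act_to_quot act_trivial //.
  exact: trivial_on_ab1.
- elim/to_quot_ind => x; elim/to_quot_ind => y v.
  by rewrite -to_quotM !act_to_quot; exact: actM.
- by move=> i j v ij; rewrite act_to_quot; exact: act_elem.
- by move=> i v; rewrite act_to_quot; exact: act_inversion.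
- move=> i; have := quotE (inversion_pal i)^-1 (inversion_pal i) (inversionV i).
  by rewrite to_quotV.
- move=> i j; have := quotE (inversion_pal i * inversion_pal j)
    (inversion_pal j * inversion_pal i) (inversionC i j).
  by rewrite !to_quotM.
- move=> i j ij; have := quotE (inversion_pal i * elem_pal i j * inversion_pal i)
    (elem_pal i j)^-1 (inversion_elem_target ij).
  by rewrite !to_quotM to_quotV.
- move=> i j ij; have := quotE (inversion_pal j * elem_pal i j * inversion_pal j)
    (elem_pal i j)^-1 (inversion_elem_source ij).
  by rewrite !to_quotM to_quotV.
- move=> i j m ij mi mj.
  have := quotE (inversion_pal m * elem_pal i j * inversion_pal m)
    (elem_pal i j) (inversion_elem_other ij mi mj).
  by rewrite !to_quotM.
- move=> i j k ij ik; have := quotE (elem_pal i j * elem_pal i k)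
    (elem_pal i k * elem_pal i j) (elem_target ij ik).
  by rewrite !to_quotM.
- move=> i j k ik jk; have [-> //|ij] := eqVneq i j.
  have : to_quot pal_sub_normal (comm (elem_pal i k) (elem_pal j k)) = 1.
    apply/to_quot_eq1; apply: (@sub_generated _ (@torelli_gens n)); left.
    exact: (elem_source_dct ik jk ij).
  rewrite /comm !(to_quotM, to_quotV) => /divg1_eq E.
  by apply: (mulIg (elem_coset i k)^-1); rewrite mulgK.
- move=> i j k l ij kl ik il jk jl; have := quotE (elem_pal i j * elem_pal k l)
    (elem_pal k l * elem_pal i j) (elem_disjoint ij kl ik il jk jl).
  by rewrite !to_quotM.
- move=> i j k ij jk ik; have := quotE (elem_pal i j * elem_pal j k)
    (elem_pal i k * elem_pal j k * elem_pal i k * elem_pal i j) (elem_chain ij jk ik).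
  by rewrite !to_quotM.
- move=> i j k ij jk ik w.
  pose u := elem_pal i j * (elem_pal i k)^-1 * elem_pal k i * elem_pal j i *
    elem_pal j k * (elem_pal k j)^-1.
  have : to_quot pal_sub_normal (u * u) = 1.
    apply/to_quot_eq1; apply: (@sub_generated _ (@torelli_gens n)); right.
    exact: (elem_triangle_spt ij jk ik).
  by rewrite /u !(to_quotM, to_quotV).
Qed.

Lemma level_word_torelli (x : pal) :
  word_in (level_gen elem_coset inversion_coset 0) (to_quot pal_sub_normal x) ->
  palindromic_torelli (x : aut (free n)) -> torelli_sub (x : aut (free n)).
Proof.
move=> wx [_ tx]; apply/(@to_quot_eq1 _ _ pal_sub_normal).
apply: (level2_faithful pal_level2_system wx) => i.
by rewrite act_to_quot act_trivial.
Qed.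

End PalindromicGroup.

(** * Generation of the palindromic automorphism group *)

Section ReducedWords.
Variable n : nat.
Local Notation F := (free n).
Implicit Types (u w : seq (letter n)) (x g : F).

Lemma fword_reduced x : reduced (fword x).
Proof. by case: x. Qed.

Lemma fword_word w : reduced w -> fword (word w) = w.
Proof. exact: reduce_id. Qed.

Definition winv w := rev (map (@linv n) w).

Lemma winv_cat u w : winv (u ++ w) = winv w ++ winv u.
Proof. by rewrite /winv map_cat rev_cat. Qed.

Lemma size_winv w : size (winv w) = size w.
Proof. by rewrite size_rev size_map. Qed.

Lemma word_winv w : word (winv w) = (word w)^-1.
Proof.
apply: (mulIg (word w)); rewrite mulVg -wordM.
by apply: val_inj; rewrite /= reduce_invl.
Qed.

Lemma winv_reduced w : reduced w -> reduced (winv w).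
Proof.
rewrite /reduced /winv rev_sorted sorted_map; apply: sub_sorted => k l /=.
by rewrite linvK eq_sym.
Qed.

Lemma fwordV x : fword x^-1 = winv (fword x).
Proof. exact/reduce_id/winv_reduced/fword_reduced. Qed.

Lemma rev_reduced w : reduced w -> reduced (rev w).
Proof.
rewrite /reduced rev_sorted; apply: sub_sorted => k l; apply: contra => /eqP->.
by rewrite linvK.
Qed.

Lemma frev_fword x : fword (frev x) = rev (fword x).
Proof. exact/reduce_id/rev_reduced/fword_reduced. Qed.

Lemma reduced_cat_cancel u w : reduced u -> reduced w ->
  exists a b c, [/\ u = a ++ c, w = winv c ++ b & reduced (a ++ b)].
Proof.
elim: w u => [|m w IH] u ru rw; first by exists u, [::], [::]; rewrite !cats0.
elim/last_ind: u ru => [|u l _] ru; first by exists [::], (m :: w), [::].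
have [ml|ml] := eqVneq l (linv m); last first.
  exists (rcons u l), (m :: w), [::]; rewrite cats0; split=> //.
  move: ru rw; rewrite /reduced; case: u => [|k u] /=; first by rewrite ml.
  by rewrite cat_path /= last_rcons ml => -> ->.
have ru' : reduced u.
  move: ru; rewrite /reduced -cats1.
  by case: (u) => //= k v; rewrite cat_path => /andP[].
have rw' : reduced w by case: (w) rw => //= k v /andP[].
have [a [b [c [ua wb rab]]]] := IH u ru' rw'.
exists a, b, (rcons c l); split=> //; first by rewrite ua rcons_cat.
by rewrite /winv map_rcons rev_rcons ml linvK wb.
Qed.

Lemma fword_mul x g : exists a b c,
  [/\ fword x = a ++ c, fword g = winv c ++ b & fword (x * g) = a ++ b].
Proof.
have [a [b [c [E1 E2 r]]]] := reduced_cat_cancel (fword_reduced x) (fword_reduced g).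
exists a, b, c; split=> //; rewrite -(fword_word r).
rewrite -[x]wordK -[g]wordK E1 E2 -wordM !wordM word_winv.
by rewrite !mulgA mulgK.
Qed.

Lemma size_fword_mul x g : size (fword (x * g)) <= size (fword x) + size (fword g).
Proof.
have [a [b [c [-> -> ->]]]] := fword_mul x g; rewrite !size_cat.
by rewrite leq_add // ?leq_addr ?leq_addl.
Qed.

Lemma size_word w : size (fword (word w)) <= size w.
Proof.
elim: w => //= l w IH; rewrite /push; case: (reduce w) IH => [|k w'] //= lt.
by case: ifP => _ /=; [exact: ltnW (ltnW _) | rewrite ltnS].
Qed.

Lemma size_fwordV x : size (fword x^-1) = size (fword x).
Proof. by rewrite fwordV size_winv. Qed.

Lemma size_frev x : size (fword (frev x)) = size (fword x).
Proof. by rewrite frev_fword size_rev. Qed.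

Lemma fword_letter (l : letter n) : fword (letter_elt l) = [:: l].
Proof. by case: l => i []. Qed.

Lemma prefix_comparable (T : eqType) (p q s : seq T) :
  prefix p s -> prefix q s -> size p <= size q -> prefix p q.
Proof.
rewrite !prefixE => /eqP ps /eqP qs le; rewrite -qs take_takel //; apply/eqP.
exact: ps.
Qed.

(* If the cancellation in [x * g] reached the middle letter of [x], [g] would
   start with the first half of [x^-1]. *)
Lemma prefix_half_mul x g h : size (fword x) = (h + h).+1 ->
  ~~ prefix (take h.+1 (fword x^-1)) (fword g) ->
  prefix (take h.+1 (fword x)) (fword (x * g)).
Proof.
move=> sx; have [a [b [c [xE gE ->]]]] := fword_mul x g.
rewrite fwordV xE winv_cat; move: sx; rewrite xE size_cat => sx.
have [ha|ah] := ltnP h (size a).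
  by move=> _; rewrite takel_cat // prefixE size_takel // takel_cat.
case/negP; rewrite gE takel_cat ?size_winv; last first.
  by rewrite -(leq_add2l (size a)) sx addnS ltnS leq_add2r.
by rewrite -{2}(cat_take_drop h.+1 (winv c)) -catA prefix_prefix.
Qed.

End ReducedWords.

(** * Half words, ping-pong and length reduction *)

Section Collins.
Variable n : nat.
Local Notation F := (free n).

(** Weaker than acting trivially on the abelianisation, so that it passes to the intermediate
    automorphisms of the length reduction. *)
Definition parity_trivial (phi : aut F) : Prop :=
  forall i m, exists c, expo (phi (gen i)) m = (unit_vec i m + 2 * c)%Z.

Definition half_size (phi : aut F) (l : letter n) : nat :=
  (size (fword (phi (letter_elt l))))./2.

(** The successor takes in the middle letter of the palindrome, which has odd length by
    [size_phi_letter]. *)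
Definition half_word (phi : aut F) (l : letter n) : seq (letter n) :=
  take (half_size phi l).+1 (fword (phi (letter_elt l))).

Lemma word_exp_rev (w : seq (letter n)) m : word_exp (rev w) m = word_exp w m.
Proof.
elim: w => [|l w IH] //; rewrite rev_cons -cats1 word_exp_cat IH.
by rewrite /word_exp /=; lia.
Qed.

Section HalfWords.
Variable phi : aut F.
Hypotheses (pal : palindromic_aut phi) (par : parity_trivial phi).

Lemma phi_letterV l : phi (letter_elt (linv l)) = (phi (letter_elt l))^-1.
Proof. by rewrite letter_eltV aut_mapV. Qed.

Lemma frev_phi l : frev (phi (letter_elt l)) = phi (letter_elt l).
Proof.
have /palindromic_frev -> := pal; congr (phi _).
by rewrite /letter_elt; case: l.2; rewrite ?frevV.
Qed.

(** A palindrome of even length has even exponent sums, whereas the exponent of the generator [l.1]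
    in its own image is odd. *)
Lemma size_phi_letter l :
  size (fword (phi (letter_elt l))) = (half_size phi l + half_size phi l).+1.
Proof.
set w := fword _; have rw : rev w = w by rewrite -frev_fword frev_phi.
have [h|ow] := boolP (odd (size w)).
  by rewrite /half_size -/w addnn -[LHS]odd_double_half h.
have sw : size w = (size w)./2 + (size w)./2.
  by rewrite addnn -[LHS]odd_double_half (negPf ow).
have E : drop (size w)./2 w = rev (take (size w)./2 w).
  by rewrite rev_take rw [X in drop (X - _)]sw addnK.
have ev m : exists c, expo (phi (letter_elt l)) m = (2 * c)%Z.
  exists (word_exp (take (size w)./2 w) m).
  rewrite /expo -/w -{1}(cat_take_drop (size w)./2 w) word_exp_cat E word_exp_rev.
  by lia.
have [c Ec] := ev l.1; have [d Ed] := par l.1 l.1; exfalso.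
rewrite {1}/letter_elt in Ec; move: Ec Ed; rewrite /unit_vec eqxx.
case: l.2; rewrite ?aut_mapV ?expoV; lia.
Qed.

Lemma half_sizeV l : half_size phi (linv l) = half_size phi l.
Proof. by rewrite /half_size phi_letterV size_fwordV. Qed.

Lemma size_half_word l : size (half_word phi l) = (half_size phi l).+1.
Proof. by rewrite size_takel // size_phi_letter ltnS leq_addr. Qed.

Lemma letter_elt_inj : injective (@letter_elt n).
Proof. by move=> l m E; have := congr1 (@fword n) E; rewrite !fword_letter => -[]. Qed.

Lemma half_word_inj l m : half_word phi l = half_word phi m -> l = m.
Proof.
move=> E; apply/letter_elt_inj/(can_inj (autK phi))/val_inj => /=.
have hs : half_size phi l = half_size phi m.
  by have := congr1 size E; rewrite !size_half_word => -[].
have half k : fword (phi (letter_elt k)) =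
    half_word phi k ++ drop 1 (rev (half_word phi k)).
  set w := fword _; have rw : rev w = w by rewrite -frev_fword frev_phi.
  rewrite -{1}(cat_take_drop (half_size phi k).+1 w); congr (_ ++ _).
  rewrite /half_word -/w rev_take rw drop_drop add1n size_phi_letter.
  by rewrite subSS addnK.
by rewrite !half E.
Qed.

Lemma ping_pong l g :
  ~~ prefix (half_word phi (linv l)) (fword g) ->
  prefix (half_word phi l) (fword (phi (letter_elt l) * g)).
Proof.
rewrite /half_word half_sizeV phi_letterV => h.
by apply: prefix_half_mul => //; exact: size_phi_letter.
Qed.

Definition prefix_code : Prop :=
  forall l m, prefix (half_word phi l) (half_word phi m) -> l = m.

(** If the image of the tail started with the half word of [linv l], that half word and the one of
    the next letter [m] would be comparable prefixes. The code property would give [linv l = m],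
    against reducedness. *)
Lemma prefix_code_word l w : prefix_code -> reduced (l :: w) ->
  prefix (half_word phi l) (fword (phi (word (l :: w)))).
Proof.
move=> code; elim: w l => [|m w IH] l rw; rewrite word_cons_elt autM; apply: ping_pong.
  rewrite word1 aut_map1; apply/prefixP => -[s /(congr1 size)].
  by rewrite size_cat size_half_word.
have /andP[lm rw'] : (l != linv m) && reduced (m :: w) by [].
apply/negP => pl; have pm := IH m rw'.
have lm' : linv l != m by apply: contra lm => /eqP<-; rewrite linvK.
case: (leqP (size (half_word phi (linv l))) (size (half_word phi m))) => le.
  by have /code E := prefix_comparable pl pm le; rewrite E eqxx in lm'.
by have /code E := prefix_comparable pm pl (ltnW le); rewrite E eqxx in lm'.
Qed.

(** The reduced word of [phi^-1 (gen i)] starts with a letter whose half word is a prefix of a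
    one-letter word; hence [phi] sends this letter to [gen i]. By parity the letter is [gen i] or
    its inverse. *)
Lemma prefix_code_gen i : prefix_code ->
  phi (gen i) = gen i \/ phi (gen i) = (gen i)^-1.
Proof.
move=> code.
have [l E] : exists l, phi (letter_elt l) = gen i.
  have E : phi (phi^-1 (gen i)) = gen i by exact: autVK.
  move: E; rewrite -[phi^-1 _]wordK; have := fword_reduced (phi^-1 (gen i)).
  case: (fword _) => [|l w] rw E; first by move: E; rewrite word1 aut_map1.
  exists l; have := prefix_code_word code rw; rewrite E => /prefixP[s].
  have : fword (gen i) = [:: (i, true)] by [].
  move=> -> Es; have := congr1 size Es; rewrite size_cat size_half_word /=.
  case hs : (half_size phi l) => [|//]; rewrite add1n => -[] /esym/size0nil s0.
  apply: val_inj => /=; rewrite Es s0 cats0 /half_word hs take_oversize //.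
  by rewrite size_phi_letter hs.
have [c] := par l.1 i; have := congr1 (fun x => expo x i) E.
rewrite expo_gen /unit_vec eqxx.
have [li|] := eqVneq i l.1; last first.
  by move: E; rewrite {1 2}/letter_elt; case: l.2 => _; rewrite ?aut_mapV ?expoV; lia.
move=> _ _; move: E; rewrite /letter_elt -li; case: l.2; first by left.
by rewrite aut_mapV => E; right; apply: invg_inj; rewrite invgK.
Qed.

Lemma elem_letter (l m : letter n) : l.1 != m.1 ->
  Sg (@elem n) (l.2 (+) m.2) l.1 m.1 (letter_elt m) =
  (letter_elt l)^-1 * letter_elt m * (letter_elt l)^-1.
Proof.
case: l m => [i b] [j c] /= /negPf ij.
by case: b; case: c; cbn beta iota delta [fst snd addb negb Sg letter_elt];
  rewrite ?aut_mapV ?(elem_same ij) ?(elemV_same ij) //; group_norm.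
Qed.

Lemma elem_fix e i j k : k != j -> Sg (@elem n) e i j (gen k) = gen k.
Proof. by move=> /negPf kj; case: e; rewrite /Sg ?elem_other ?elemV_other. Qed.

(** Let [p] be the half word of [l]. The two images are [p r] and [p z p^rev], and the product
    reduces to [r^-1 z (r^rev)^-1]. Since [r] is one letter shorter than [p], at least two letters
    are saved. *)
Lemma size_shortened l m : prefix (half_word phi l) (half_word phi m) -> l != m ->
  size (fword ((phi (letter_elt l))^-1 * phi (letter_elt m) * (phi (letter_elt l))^-1))
    < size (fword (phi (letter_elt m))).
Proof.
move=> pre lm; set h := half_size phi l.
have lt : h < half_size phi m.
  rewrite ltnNge; apply/negP => le; case/eqP: lm; apply/esym/half_word_inj.
  by move: pre; rewrite prefixE take_oversize ?size_half_word // => /eqP.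
have [ul vl] := (size_phi_letter l, size_phi_letter m).
have [fl fm] := (frev_phi l, frev_phi m).
set x := phi _ in ul fl *; set y := phi _ in vl fm *.
have [r [xr sr]] : exists r, x = word (half_word phi l) * word r /\ size r = h.
  exists (drop h.+1 (fword x)); rewrite -wordM cat_take_drop wordK; split=> //.
  by rewrite size_drop ul subSS addnK.
have xr' : x = frev (word r) * frev (word (half_word phi l)) by rewrite -frevM -xr.
have [z [yz sz]] : exists z, y = word (half_word phi l) * word z *
    frev (word (half_word phi l)) /\ size z + (h + h).+2 = size (fword y).
  have le : h.+1 + h.+1 <= size (fword y).
    rewrite vl addSn addnS ltnS; apply: (@leq_trans (h.+1 + half_size phi m)).
      by rewrite addSn ltnS leq_add2l ltnW.
    by rewrite leq_add2r.
  have preY : take h.+1 (fword y) = half_word phi l.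
    have /eqP : half_word phi l == take h.+1 (half_word phi m).
      by move: pre; rewrite prefixE size_half_word eq_sym.
    by rewrite /half_word take_takel // ltnS ltnW.
  exists (drop h.+1 (take (size (fword y) - h.+1) (fword y))); split.
    rewrite frev_word -!wordM -preY -[LHS]wordK; congr word.
    have E : rev (take h.+1 (fword y)) = drop (size (fword y) - h.+1) (fword y).
      by rewrite rev_take -frev_fword fm.
    have lek : h.+1 <= size (fword y) - h.+1.
      by rewrite leq_subRL // (leq_trans _ le) // leq_addr.
    by rewrite E -{1}(take_takel (fword y) lek) !cat_take_drop.
  have -> : (h + h).+2 = h.+1 + h.+1 by rewrite addSn addnS.
  by rewrite size_drop (size_takel (leq_subr _ _)) -subnDA subnK.
have -> : x^-1 * y * x^-1 = (word r)^-1 * word z * (frev (word r))^-1.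
  by rewrite {1}xr xr' yz !invgM !mulgA !mulgVK mulgK.
set r' := word r.
apply: leq_ltn_trans (size_fword_mul _ _) _.
apply: leq_ltn_trans (leq_add (size_fword_mul _ _) (leqnn _)) _.
rewrite !size_fwordV size_frev -sz.
have sr' : size (fword r') <= h by rewrite -sr; exact: size_word.
have sz' := size_word z.
rewrite !addnS !ltnS (leq_trans (leq_add (leq_add sr' sz') sr')) //.
by rewrite (addnC h) -addnA ltnW.
Qed.

End HalfWords.

Definition aut_gen : aut F -> Prop := level_gen (@elem n) (@inversion n) 0.

Lemma aut_gen_Sg e i j : i != j -> aut_gen (Sg (@elem n) e i j).
Proof. by move=> ij; left; exists e, i, j. Qed.

Lemma Sg_palindromic e i j : palindromic_aut (Sg (@elem n) e i j).
Proof. by case: e; [|apply: palindromicV]; apply: elem_palindromic. Qed.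

Lemma sign_change_word (phi : aut F) :
  (forall i, phi (gen i) = gen i \/ phi (gen i) = (gen i)^-1) -> word_in aut_gen phi.
Proof.
have [N] := ubnP #|[pred i | phi (gen i) != gen i]|.
elim: N phi => // N IH phi; rewrite ltnS => leN sgn.
case: (pickP [pred i | phi (gen i) != gen i]) => [i /= phii|fixed]; last first.
  have -> : phi = 1 by apply: aut_gens_ext => i; have /eqP := negbFE (fixed i).
  exact: word_nil.
have E : phi (gen i) = (gen i)^-1.
  by case: (sgn i) => // E; rewrite E eqxx in phii.
have -> : phi = (phi * inversion i) * inversion i.
  by rewrite -{2}(inversionV i) mulgK.
apply: word_mul; last by apply: word_gen; right; exists i.
have psi_i : (phi * inversion i) (gen i) = gen i.
  by rewrite aut_mulE inversion_same aut_mapV E invgK.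
have psi_j j : j != i -> (phi * inversion i) (gen j) = phi (gen j).
  by move=> /negPf ji; rewrite aut_mulE inversion_other.
apply: IH => [|j]; last first.
  by have [->|ji] := eqVneq j i; [left | rewrite psi_j].
apply: leq_trans leN; apply: proper_card; apply/properP; split.
  apply/fintype.subsetP => j; rewrite !inE; have [->|ji] := eqVneq j i.
    by rewrite psi_i eqxx.
  by rewrite psi_j.
by exists i; rewrite !inE ?psi_i ?eqxx.
Qed.

Definition total_size (phi : aut F) := \sum_(i < n) size (fword (phi (gen i))).

Lemma size_letter (phi : aut F) l :
  size (fword (phi (letter_elt l))) = size (fword (phi (gen l.1))).
Proof. by rewrite /letter_elt; case: l.2; rewrite // aut_mapV size_fwordV. Qed.

Theorem palindromic_generation (phi : aut F) :
  palindromic_aut phi -> parity_trivial phi -> word_in aut_gen phi.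
Proof.
have [N] := ubnP (total_size phi).
elim: N phi => // N IH phi; rewrite ltnS => leN pal par.
have [code|/existsNP[l /existsNP[m /not_implyP[pre /eqP lm]]]] :=
    pselect (prefix_code phi).
  by apply: sign_change_word => i; exact: prefix_code_gen.
(* The half words of a letter and its inverse have equal length, so if one were a prefix of the
   other they would coincide. *)
have ij : l.1 != m.1.
  apply/negP => /eqP E; case/eqP: lm; apply: (half_word_inj pal par).
  have sz : half_size phi l = half_size phi m by rewrite /half_size !size_letter E.
  move: pre; rewrite prefixE take_oversize; last by rewrite !size_half_word // sz.
  by move/eqP.
have lt := size_shortened pal par pre lm.
set e := l.2 (+) m.2; pose psi := phi * Sg (@elem n) e l.1 m.1.
have -> : phi = psi * (Sg (@elem n) e l.1 m.1)^-1 by rewrite mulgK.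
apply: word_mul; last by apply: word_gen; rewrite SgV; exact: aut_gen_Sg.
have psi_j j : j != m.1 -> psi (gen j) = phi (gen j).
  by move=> jm; rewrite aut_mulE elem_fix.
apply: IH.
- apply: leq_trans leN; rewrite /total_size (bigD1 m.1) // [ltnRHS](bigD1 m.1) //.
  rewrite (eq_bigr (fun j => size (fword (phi (gen j))))); last first.
    by move=> j /andP[_ jm]; rewrite psi_j.
  rewrite -addSn leq_add2r -!size_letter aut_mulE elem_letter // !autM aut_mapV.
  exact: lt.
- by apply: palindromicM => //; exact: Sg_palindromic.
- move=> j p; have [->|jm] := eqVneq j m.1; last by rewrite psi_j //; exact: par.
  have [c E] := par m.1 p; rewrite aut_mulE.
  have -> : Sg (@elem n) e l.1 m.1 (gen m.1) =
      letter_elt (l.1, e) * gen m.1 * letter_elt (l.1, e).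
    by case: (e); rewrite /Sg ?elem_same ?elemV_same // (negPf ij).
  exists (c + expo (phi (letter_elt (l.1, e))) p)%Z.
  by rewrite !autM !expoM E; lia.
Qed.

Lemma aut_gen_coset (phi : aut F) : word_in aut_gen phi ->
  exists2 x : pal n, phi = x & word_in
    (level_gen (@elem_coset n) (@inversion_coset n) 0) (to_quot (@pal_sub_normal n) x).
Proof.
elim=> [|a g ga _ [x -> wx]]; first by exists 1 => //; constructor.
suff [y -> gy] : exists2 y : pal n, a = y & level_gen (@elem_coset n)
    (@inversion_coset n) 0 (to_quot (@pal_sub_normal n) y).
  by exists (y * x) => //; rewrite to_quotM; constructor.
case: ga => [[e [i [j [_ _ ij ->]]]]|[i _ ->]].
  exists (Sg (@elem_pal n) e i j); first by case: e.
  left; exists e, i, j; split=> //.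
  by case: e; rewrite /Sg ?to_quotV.
by exists (inversion_pal i) => //; right; exists i.
Qed.

End Collins.

Lemma torelli_parity (n : nat) (phi : aut (free n)) :
  palindromic_torelli phi -> parity_trivial phi.
Proof.
by case=> _ t i m; exists 0%Z; rewrite expo_trivial // expo_gen; lia.
Qed.

Theorem theorem1 (n : nat) (hn : (3 <= n)%N) :
  @palindromic_torelli n =
    generated (@doubled_commutator_transvection n `|` @separating_pi_twist n).
Proof.
apply/seteqP; split; last exact: torelli_sub_torelli.
move=> phi tphi; have [pal _] := tphi.
have [x xE wx] := aut_gen_coset (palindromic_generation pal (torelli_parity tphi)).
by move: tphi; rewrite xE => /(level_word_torelli wx).
Qed.
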